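(* Let $Z_2^{real}$ be the real Kalton-Peck space and let $\mathsf{KP}^{real}$ be its differential. Then: (1) $Z_2^{real}$ is isomorphic to its dual. (2) $\mathsf{KP}^{real}$ is singular. (3) $Z_2^{real}$ does not contain complemented copies of $\ell_2$.
   Context: All spaces are real; $\ell_2$ in (3) is the real Hilbert space $\ell_2(\mathbb R)$ of square-summable real sequences. Isomorphic means linearly homeomorphic. A complemented copy of $\ell_2$ in $Z$ is a closed subspace of $Z$ isomorphic to $\ell_2$ that is the range of a continuous linear projection on $Z$. Real Kalton-Peck space. $Z_2^{real}$ is the derived space obtained from the pair $(\ell_\infty,\ell_1)$ by real interpolation at $(1/2,1/2)$, the real method being presented in the following discrete form. Put $B_0=\ell_\infty$, $B_1=\ell_1$, $p_0=\infty$, $p_1=1$, $\theta=1/2$, with ambient space $\Sigma$ a sequence space containing both $B_0$ and $B_1$ (e.g. $\Sigma=\ell_\infty$). Let $\mathcal J$ be the space of all sequences $\{b_n\}_{n\in\mathbb Z}$ in $B_0\cap B_1$ with $\{e^{jn}b_n\}_{n\in\mathbb Z}\in \ell_{p_j}(\mathbb Z;B_j)$ for $j=0,1$, normed by $\max_{j=0,1}\|\{e^{jn}b_n\}\|_{\ell_{p_j}(B_j)}$. The interpolation space $\{\sum_{n} e^{\theta n}b_n : \{b_n\}\in\mathcal J\}$ with the quotient norm is $\ell_2(\mathbb R)$ up to an equivalent norm. Fix $C>1$ and choose, homogeneously in $b$, for each $b\in \ell_2(\mathbb R)$ a sequence $\{b_n\}\in\mathcal J$ with $\sum_n e^{\theta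 n}b_n=b$ and $\|\{b_n\}\|_{\mathcal J}\le C\|b\|$. The associated differential is $\Omega(b)=\sum_{n\in\mathbb Z} n e^{\theta(n-1)}b_n\in\Sigma$. The derived space is the set of pairs $(x,y)\in \Sigma\times \ell_2(\mathbb R)$ with $x-\Omega(y)\in\ell_2(\mathbb R)$, endowed with the quasi-norm $\|x-\Omega(y)\|_2+\|y\|_2$ (which is equivalent to a norm). Another choice of $\{b_n\}$ changes $\Omega$ by a bounded map into $\ell_2(\mathbb R)$, so it gives the same space with an equivalent quasi-norm. The differential used in the paper is $$\mathsf{KP}^{real}(a)=2e^{-1/2}\sum_m\left[\log\frac{|a_m|}{\|a\|_2}\right]a_m e_m\qquad (0\ne a\in\ell_2(\mathbb R)),\qquad \mathsf{KP}^{real}(0)=0,$$ where $[\cdot]$ denotes the integer part and terms with $a_m=0$ are $0$. So $Z_2^{real}$ is the space of pairs $(x,y)$ with $y\in\ell_2(\mathbb R)$, $x-\mathsf{KP}^{real}(y)\in\ell_2(\mathbb R)$, with quasi-norm $\|x-\mathsf{KP}^{real}(y)\|_2+\|y\|_2$, and there is an exact sequence $0\to\ell_2(\mathbb R)\to Z_2^{real}\to\ell_2(\mathbb R)\to0$ with inclusion $x\mapsto(x,0)$ and quotient map $(x,y)\mapsto y$. Singular: an exact sequence generated in this way by $\Omega$ (or the map $\Omega$ itself) is called singular when its quotient map is a strictly singular operator, i.e. its restriction to any infinite dimensional closed subspace is not an isomorphism onto its range. Equivalently, the restriction of $\Omega$ to any infinite dimensional closed subspace is never the sum of a bounded map (into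 $\ell_2$) and a linear map. *)

(* Defs.v *)
From HB Require Import structures.
From mathcomp Require Import all_boot all_order all_algebra.
From mathcomp Require Import boolp classical_sets functions reals.
From mathcomp Require Import topology normedtype sequences exp.

Set Implicit Arguments.
Unset Strict Implicit.
Unset Printing Implicit Defensive.

Import Order.TTheory GRing.Theory Num.Theory.
Import numFieldNormedType.Exports.

Local Open Scope classical_set_scope.
Local Open Scope ring_scope.

(* A quasi-normed space is given by its underlying set [car] inside an ambient
   vector space, and by its quasi-norm [qn]; the values of [qn] outside [car]
   are irrelevant.  Likewise a map between two such spaces is a function between
   the ambient spaces, considered only on [car]. *)
Record qnSpace (R : realType) := QNSpace {
  amb : lmodType R;
  car : set amb;
  qn : amb -> R }.

Arguments QNSpace {R amb} car qn.

Section QuasiNormedSpaces.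
Context {R : realType}.
Implicit Types X Y : qnSpace R.

Definition linear_map X Y (T : amb X -> amb Y) : Prop :=
  (forall x, car x -> car (T x)) /\
  (forall (a : R) x y, car x -> car y -> T (a *: x + y) = a *: T x + T y).

(* The balls of the quasi-norm need not be open, but those centred at [x] form
   a base of neighbourhoods of [x]. *)
Definition continuous_map X Y (T : amb X -> amb Y) : Prop :=
  forall x, car x -> forall e : R, 0 < e ->
    exists2 d : R, 0 < d &
      forall y, car y -> qn (y - x) < d -> qn (T y - T x) < e.

Definition isomorphism X Y (T : amb X -> amb Y) : Prop :=
  [/\ linear_map T, continuous_map T &
   exists S : amb Y -> amb X,
     [/\ linear_map S, continuous_map S,
         forall x, car x -> S (T x) = x & forall y, car y -> T (S y) = y]].

Definition isomorphic X Y : Prop :=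
  exists T : amb X -> amb Y, isomorphism T.

Definition subspace X (W : set (amb X)) : Prop :=
  [/\ W `<=` @car R X, W 0 & forall (a : R) x y, W x -> W y -> W (a *: x + y)].

Definition closed_subspace X (W : set (amb X)) : Prop :=
  subspace W /\
  forall x, car x ->
    (forall e : R, 0 < e -> exists2 w, W w & qn (w - x) < e) -> W x.

Definition finite_dimensional X (W : set (amb X)) : Prop :=
  exists (n : nat) (v : 'I_n -> amb X),
    forall w, W w -> exists c : 'I_n -> R, w = \sum_(i < n) c i *: v i.

Definition induced X (W : set (amb X)) : qnSpace R := QNSpace W (@qn R X).

Definition strictly_singular X Y (T : amb X -> amb Y) : Prop :=
  forall W : set (amb X), closed_subspace W -> ~ finite_dimensional W ->
    ~ @isomorphism (induced W) (induced (T @` W)) T.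

Definition complemented_copy X Y (W : set (amb X)) : Prop :=
  [/\ closed_subspace W, isomorphic (induced W) Y &
   exists P : amb X -> amb X,
     [/\ @linear_map X X P, @continuous_map X X P,
         forall x, car x -> P (P x) = P x & P @` @car R X = W]].

Definition scalars : qnSpace R := @QNSpace R R^o setT (fun x => `|x|).

(* A functional on [car] is represented by its extension by zero, so that
   distinct elements of the dual are distinct functionals on [car]. *)
Definition dual X : qnSpace R :=
  @QNSpace R (amb X -> R^o)
    [set f | [/\ @linear_map X scalars f, @continuous_map X scalars f &
                 forall x, ~ car x -> f x = 0]]
    (fun f => sup [set `|f x| | x in [set x | car x /\ qn x <= 1]]).

Definition seq_space : lmodType R := nat -> R^o.

Definition square_summable (x : seq_space) : Prop :=
  cvgn (series (fun n => (x n : R) ^+ 2)).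

Definition norm2 (x : seq_space) : R :=
  Num.sqrt (limn (series (fun n => (x n : R) ^+ 2))).

Definition ell2 : qnSpace R := QNSpace [set x | square_summable x] norm2.

(* The first component ranges over all real sequences: membership in a smaller
   sequence space containing ell2 and the values of Omega on ell2 would be
   automatic. *)
Definition derived_space (Omega : seq_space -> seq_space) : qnSpace R :=
  @QNSpace R (seq_space * seq_space)%type
    [set p | square_summable p.2 /\ square_summable (p.1 - Omega p.2)]
    (fun p => norm2 (p.1 - Omega p.2) + norm2 p.2).

Definition quotient_map (Omega : seq_space -> seq_space)
  (p : amb (derived_space Omega)) : amb ell2 := p.2.

Definition singular (Omega : seq_space -> seq_space) : Prop :=
  strictly_singular (@quotient_map Omega).

(* This is sum_n n e^((n-1)/2) b_n for the decomposition a = sum_n e^(n/2) b_n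
   in which b_n is e^(-n/2) a on the coordinates m such that n = 2k with k the
   integer part of log (|a_m| / ||a||_2), and 0 elsewhere.
   The conventions for the values of ln and of the inverse at 0 play no role:
   the m-th term is 0 when a_m = 0, so that KP 0 = 0. *)
Definition KP (a : seq_space) : seq_space := fun m =>
  2 * expR (- 2^-1) * (Num.floor (ln (`|(a m : R)| / norm2 a)))%:~R * (a m : R).

Definition Z2 : qnSpace R := derived_space KP.

End QuasiNormedSpaces.

Arguments complemented_copy {R} X Y W.
Arguments ell2 R : clear implicits.
Arguments Z2 R : clear implicits.
Arguments KP R : clear implicits.

(* Main.v *)
(* Write c = 2 e^(-1/2), let KP be the map of the statement and consider the
   alternating form B((x,y),(u,v)) = sum_m (x_m v_m - y_m u_m) on Z2.  The
   inequality a b |ln (a/b)| <= a^2 + b^2 gives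
   sum_m |KP(y)_m v_m - y_m KP(v)_m| <= 3 c |y| |v|,
   so B is well defined and bounded.
   (1) w |-> B(w, .) is an isomorphism onto the dual; its inverse sends f to
   (u,v) with u_m = f(0,e_m) and v_m = - f(e_m,0).
   (2), (3) Let p_k = (x_k,y_k) in Z2 satisfy |sum_k a_k p_k| <= K |a|_2; then
   y_k -> 0.  Otherwise, a gliding hump yields N of the y_k with disjoint blocks
   z_k of norm >= d.  For signs e let w_e = sum_k e_k z_k, so that its norm D
   is at least d sqrt N.  Averaging B(sum_k e_k p_k, (KP w_e, w_e)) over e
   leaves only diagonal terms, which differ from the sum of the
   B(p_k, (KP z_k, z_k)) by at least c D^2 (ln (D/K) - 1), while both
   quantities are O(D^2): so N is bounded.
   For (2), apply this to p_k in W with orthonormal second coordinates.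
   For (3), given A : l2 -> Z2 and A' : Z2 -> l2 with A' A = id, the adjoint
   A'^* of A' with respect to B satisfies 1 = B(A'^* e_n, A e_n), and the
   second coordinates of both A e_n and A'^* e_n tend to 0. *)
Require Import Defs.
From HB Require Import structures.
From mathcomp Require Import all_boot all_order all_algebra.
From mathcomp Require Import boolp classical_sets functions reals.
From mathcomp Require Import topology normedtype sequences exp.
From mathcomp Require Import ring lra.

Set Implicit Arguments.
Unset Strict Implicit.
Unset Printing Implicit Defensive.

Import Order.TTheory GRing.Theory Num.Theory.
Import numFieldNormedType.Exports.

Local Open Scope classical_set_scope.
Local Open Scope ring_scope.

(** * The Hilbert space of square-summable sequences *)

Section FiniteSums.
Context {R : realType}.
Implicit Types (x y : nat -> R) (a b c : R).

(** Cauchy-Schwarz for partial sums, with arbitrary upper bounds [a], [b] in place of the norms. It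
    follows from the weighted inequality [2 u v <= (b / a) u^2 + (a / b) v^2], so [a = 0] and
    [b = 0] are treated apart. *)
Lemma sum_norm_mul_le n x y a b : 0 <= a -> 0 <= b ->
  \sum_(0 <= i < n) x i ^+ 2 <= a ^+ 2 ->
  \sum_(0 <= i < n) y i ^+ 2 <= b ^+ 2 ->
  \sum_(0 <= i < n) `|x i * y i| <= a * b.
Proof.
have zero u v : \sum_(0 <= i < n) u i ^+ 2 <= (0 : R) ^+ 2 ->
    \sum_(0 <= i < n) `|u i * v i| <= 0 :> R.
  rewrite expr0n/= => u0; rewrite big_nat big1 // => i /andP[_ ni].
  have : u i ^+ 2 <= 0.
    apply: le_trans u0; rewrite big_mkord (bigD1 (Ordinal ni)) //= lerDl.
    by apply: sumr_ge0 => j _; exact: sqr_ge0.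
  by rewrite real_exprn_even_le0 ?num_real//= => /eqP ->; rewrite mul0r normr0.
rewrite le0r => /orP[/eqP->|a0].
  by move=> _ x0 _; rewrite mul0r; exact: zero.
rewrite le0r => /orP[/eqP->|b0].
  move=> _ y0; rewrite mulr0.
  by under eq_bigr do rewrite mulrC; exact: zero.
move=> xa yb.
have -> : a * b = (b / a * a ^+ 2 + a / b * b ^+ 2) / 2 by field; lra.
apply: (@le_trans _ _ (\sum_(0 <= i < n)
   (b / a * x i ^+ 2 + a / b * y i ^+ 2) / 2)).
  apply: ler_sum => i _; rewrite normrM.
  rewrite -(real_normK (num_real (x i))) -(real_normK (num_real (y i))).
  set u := `|x i|; set v := `|y i|.
  rewrite -subr_ge0.
  have -> : (b / a * u ^+ 2 + a / b * v ^+ 2) / 2 - u * v =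
            (b * u - a * v) ^+ 2 / (2 * a * b) by field; lra.
  by rewrite divr_ge0 ?sqr_ge0// !mulr_ge0// ltW.
rewrite -mulr_suml big_split/= -!mulr_sumr ler_pM2r ?invr_gt0//.
by apply: lerD; rewrite ler_pM2l// divr_gt0.
Qed.

Lemma sum_mul_le n x y a b : 0 <= a -> 0 <= b ->
  \sum_(0 <= i < n) x i ^+ 2 <= a ^+ 2 ->
  \sum_(0 <= i < n) y i ^+ 2 <= b ^+ 2 ->
  \sum_(0 <= i < n) x i * y i <= a * b.
Proof.
move=> a0 b0 xa yb; apply: le_trans (sum_norm_mul_le a0 b0 xa yb).
by apply: ler_sum => i _; exact: ler_norm.
Qed.

Lemma sum_sqrD_le n x y a b : 0 <= a -> 0 <= b ->
  \sum_(0 <= i < n) x i ^+ 2 <= a ^+ 2 ->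
  \sum_(0 <= i < n) y i ^+ 2 <= b ^+ 2 ->
  \sum_(0 <= i < n) (x i + y i) ^+ 2 <= (a + b) ^+ 2.
Proof.
move=> a0 b0 xa yb; under eq_bigr do rewrite sqrrD.
rewrite big_split big_split/= sumrMnl sqrrD lerD// lerD// lerMn2r/=.
exact: sum_mul_le.
Qed.

End FiniteSums.

Section SquareSummable.
Context {R : realType}.
Implicit Types (x y : @seq_space R) (a b c : R).

Lemma norm2_ge0 x : 0 <= norm2 x.
Proof. exact: sqrtr_ge0. Qed.

Let nds x : nondecreasing_seq (series (fun n => (x n : R) ^+ 2)).
Proof. by apply: nondecreasing_series => i _ _; exact: sqr_ge0. Qed.

Lemma sqr_norm2 x : square_summable x ->
  norm2 x ^+ 2 = limn (series (fun n => (x n : R) ^+ 2)).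
Proof.
move=> xs; rewrite sqr_sqrtr//; apply: limr_ge => //.
by apply: nearW => n; apply: sumr_ge0 => i _; exact: sqr_ge0.
Qed.

Lemma sum_sqr_le_norm2 x n : square_summable x ->
  \sum_(0 <= i < n) (x i : R) ^+ 2 <= norm2 x ^+ 2.
Proof.
by move=> xs; rewrite sqr_norm2//; exact: (nondecreasing_cvgn_le (@nds x) xs n).
Qed.

Lemma square_summable_bounded x c :
  (forall n, \sum_(0 <= i < n) (x i : R) ^+ 2 <= c) -> square_summable x.
Proof.
move=> xc; apply: (nondecreasing_is_cvgn (@nds x)).
by exists c => _ [n _ <-]; exact: xc.
Qed.

Lemma norm2_le x c : 0 <= c ->
  (forall n, \sum_(0 <= i < n) (x i : R) ^+ 2 <= c ^+ 2) -> norm2 x <= c.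
Proof.
move=> c0 xc; rewrite -ler_sqr ?nnegrE ?norm2_ge0//.
have xs := square_summable_bounded xc.
by rewrite sqr_norm2//; apply: limr_le => //; exact: nearW.
Qed.

Lemma norm_le_norm2 x n : square_summable x -> `|x n : R| <= norm2 x.
Proof.
move=> xs; rewrite -ler_sqr ?nnegrE ?norm2_ge0// real_normK ?num_real//.
apply: le_trans (sum_sqr_le_norm2 n.+1 xs); rewrite big_nat_recr//= lerDr.
by apply: sumr_ge0 => i _; exact: sqr_ge0.
Qed.

Lemma square_summable_le x y c : square_summable y ->
  (forall n, `|x n : R| <= c * `|y n : R|) -> square_summable x.
Proof.
move=> ys xy; apply: (@square_summable_bounded _ (c ^+ 2 * norm2 y ^+ 2)) => n.
apply: le_trans (ler_wpM2l (sqr_ge0 c) (sum_sqr_le_norm2 n ys)).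
rewrite mulr_sumr; apply: ler_sum => i _.
rewrite -(real_normK (num_real (x i))) -(real_normK (num_real (y i))) -exprMn.
by rewrite lerXn2r ?nnegrE// (le_trans _ (xy i)).
Qed.

Lemma square_summableZ a x : square_summable x -> square_summable (a *: x).
Proof.
by move=> xs; apply: (@square_summable_le _ x `|a|) => // n; rewrite -normrM.
Qed.

Lemma square_summableD x y :
  square_summable x -> square_summable y -> square_summable (x + y).
Proof.
move=> xs ys.
apply: (@square_summable_bounded _ ((norm2 x + norm2 y) ^+ 2)) => n.
apply: sum_sqrD_le => //; rewrite ?norm2_ge0//; exact: sum_sqr_le_norm2.
Qed.

Lemma square_summableN x : square_summable x -> square_summable (- x).
Proof. by rewrite -scaleN1r; exact: square_summableZ. Qed.

Lemma square_summableB x y :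
  square_summable x -> square_summable y -> square_summable (x - y).
Proof. by move=> xs ys; apply/square_summableD/square_summableN. Qed.

Lemma norm2Z a x : square_summable x -> norm2 (a *: x) = `|a| * norm2 x.
Proof.
move=> xs; rewrite /norm2 -sqrtr_sqr -sqrtrM ?sqr_ge0//; congr Num.sqrt.
transitivity (limn (a ^+ 2 \*: series (fun n => (x n : R) ^+ 2))).
  congr (limn _); apply/funext => n; rewrite /series/= scaler_sumr.
  by apply: eq_bigr => i _; rewrite -[LHS]/((a * (x i : R)) ^+ 2) exprMn.
by rewrite limZr.
Qed.

End SquareSummable.

(** * Absolutely convergent and finite real series *)

Section Series.
Context {R : realType}.
Implicit Types (u v : nat -> R) (a c : R).

Lemma cvg_series_norm_le u c : (forall n, \sum_(0 <= i < n) `|u i| <= c) ->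
  cvgn (series u) /\ `|limn (series u)| <= c.
Proof.
move=> uc; have cu : cvgn (series u).
  apply: normed_cvg; apply: nondecreasing_is_cvgn.
    by apply: nondecreasing_series => i _ _; exact: normr_ge0.
  by exists c => _ [n _ <-]; exact: uc.
split=> //; rewrite ler_norml; apply/andP; split.
  apply: limr_ge => //; apply: nearW => n; rewrite lerNl -sumrN.
  by apply: le_trans (uc n); apply: ler_sum => i _; rewrite -normrN ler_norm.
apply: limr_le => //; apply: nearW => n; apply: le_trans (uc n).
by apply: ler_sum => i _; rewrite ler_norm.
Qed.

Lemma cvg_series_linear a u v :
  cvgn (series u) -> cvgn (series v) ->
  series (fun n => a * u n + v n) @ \oo -->
  a * limn (series u) + limn (series v).
Proof.
move=> cu cv.
rewrite (_ : series _ = (fun n => a * series u n + series v n)).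
  by apply: cvgD => //; apply: cvgMr.
by apply/funext => n; rewrite /series/= mulr_sumr big_split.
Qed.

Lemma lim_series_linear a u v :
  cvgn (series u) -> cvgn (series v) ->
  limn (series (fun n => a * u n + v n)) =
  a * limn (series u) + limn (series v).
Proof. by move=> cu cv; apply: cvg_lim => //; exact: cvg_series_linear. Qed.

Lemma lim_series_finite u n : (forall m, (n <= m)%N -> u m = 0) ->
  limn (series u) = \sum_(0 <= i < n) u i.
Proof.
move=> u0; apply: lim_near_cst => //; near=> m.
have nm : (n <= m)%N by near: m; exact: nbhs_infty_ge.
rewrite /series/= (big_cat_nat (leq0n _) nm)//=.
rewrite [X in _ + X]big_nat [X in _ + X]big1 ?addr0//.
by move=> i /andP[ni _]; exact: u0.
Unshelve. all: by end_near. Qed.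

End Series.

(** * Inner product, truncations and unit vectors *)

Section Dot.
Context {R : realType}.
Local Notation seqs := (@seq_space R).
Implicit Types (x y z : seqs) (a b c : R).

Definition dot x y : R := limn (series (fun n => (x n : R) * y n)).

Lemma dotC x y : dot x y = dot y x.
Proof. by congr (limn (series _)); apply/funext => n; rewrite mulrC. Qed.

Lemma cvg_dot x y : square_summable x -> square_summable y ->
  cvgn (series (fun n => (x n : R) * y n)) /\ `|dot x y| <= norm2 x * norm2 y.
Proof.
move=> xs ys; apply: cvg_series_norm_le => n.
by apply: sum_norm_mul_le; rewrite ?norm2_ge0//; exact: sum_sqr_le_norm2.
Qed.

Lemma dot_linearl a x y z :
  square_summable x -> square_summable y -> square_summable z ->
  dot (a *: x + y) z = a * dot x z + dot y z.
Proof.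
move=> xs ys zs; rewrite /dot -lim_series_linear; [|exact: (cvg_dot _ _).1..].
congr (limn (series _)); apply/funext => n.
by rewrite -[LHS]/((a * x n + y n) * z n) mulrDl mulrA.
Qed.

Lemma dot_linearr a x y z :
  square_summable x -> square_summable y -> square_summable z ->
  dot z (a *: x + y) = a * dot z x + dot z y.
Proof. by move=> xs ys zs; rewrite dotC dot_linearl// !(dotC _ z). Qed.

Lemma dotxx x : square_summable x -> dot x x = norm2 x ^+ 2.
Proof. by move=> xs; rewrite sqr_norm2. Qed.

Definition trunc n x : seqs := fun m => if (m < n)%N then x m else 0.

Definition unit_seq n : seqs := fun m => (m == n)%:R.

Lemma square_summable_finite n x : (forall m, (n <= m)%N -> x m = 0) ->
  square_summable x /\ norm2 x ^+ 2 = \sum_(0 <= i < n) (x i : R) ^+ 2.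
Proof.
move=> x0; have xs : square_summable x.
  apply: (@square_summable_bounded _ _ (\sum_(0 <= i < n) (x i : R) ^+ 2)) => m.
  have [mn|/ltnW nm] := leqP m n.
    rewrite (big_cat_nat (leq0n _) mn)//= lerDl.
    by apply: sumr_ge0 => i _; exact: sqr_ge0.
  rewrite (big_cat_nat (leq0n _) nm)//=.
  rewrite [X in _ + X]big_nat [X in _ + X]big1 ?addr0//.
  by move=> i /andP[ni _]; rewrite x0// expr0n.
by split=> //; rewrite sqr_norm2//; apply: lim_series_finite => m /x0 ->;
  rewrite expr0n.
Qed.

Lemma square_summable0 : square_summable (0 : seqs).
Proof. by have [] := @square_summable_finite 0 0. Qed.

Lemma norm2_0 : norm2 (0 : seqs) = 0.
Proof.
have [_] := @square_summable_finite 0 0 (fun _ _ => erefl).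
by rewrite big_geq// => /eqP; rewrite sqrf_eq0 => /eqP.
Qed.

Lemma norm2_eq0 x : square_summable x -> norm2 x = 0 -> x = 0.
Proof.
move=> xs x0; apply/funext => n; apply/eqP; rewrite -normr_le0.
by rewrite -[leRHS]x0; exact: norm_le_norm2.
Qed.

Lemma norm2_gt0 x : square_summable x -> x <> 0 -> 0 < norm2 x.
Proof.
move=> xs x0; rewrite lt0r norm2_ge0 andbT; apply/eqP => /norm2_eq0.
by move=> /(_ xs).
Qed.

Lemma square_summable_trunc n x : square_summable (trunc n x) /\
  norm2 (trunc n x) ^+ 2 = \sum_(0 <= i < n) (x i : R) ^+ 2.
Proof.
have [|ts ->] := @square_summable_finite n (trunc n x).
  by move=> m nm; rewrite /trunc ltnNge nm.
by split=> //; apply: eq_big_nat => i /andP[_ ni]; rewrite /trunc ni.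
Qed.

Lemma square_summable_unit_seq n : square_summable (unit_seq n).
Proof.
have [|//] := @square_summable_finite n.+1 (unit_seq n).
by move=> m nm; rewrite /unit_seq gtn_eqF.
Qed.

Lemma sum_seqE (I : Type) (r : seq I) (P : pred I) (F : I -> seqs) m :
  (\sum_(i <- r | P i) F i) m = \sum_(i <- r | P i) (F i m : R).
Proof. by elim/big_rec2: _ => // i u v _ <-. Qed.

Lemma trunc_unit_seq n x : trunc n x = \sum_(0 <= i < n) x i *: unit_seq i.
Proof.
apply/funext => m; rewrite sum_seqE /trunc big_mkord.
under eq_bigr do rewrite -[_ m]/((x _ : R) * _).
case: ltnP => [mn|nm].
  rewrite (bigD1 (Ordinal mn))//= /unit_seq eqxx mulr1 big1 ?addr0//.
  move=> i; rewrite -val_eqE/= eq_sym => /negbTE.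
  by move=> im; rewrite im mulr0.
rewrite big1// => i _; rewrite /unit_seq.
by rewrite gtn_eqF ?mulr0// (leq_trans (ltn_ord i)).
Qed.

Lemma dot_unit_seqr x n : dot x (unit_seq n) = x n.
Proof.
rewrite /dot (@lim_series_finite _ _ n.+1); last first.
  by move=> m nm; rewrite /unit_seq gtn_eqF// mulr0.
rewrite big_nat_recr//= /unit_seq eqxx mulr1 big_nat big1 ?add0r//.
by move=> i /andP[_ ni]; rewrite ltn_eqF// mulr0.
Qed.

Lemma norm2_tail_small x e : square_summable x -> 0 < e ->
  exists n, norm2 (x - trunc n x) <= e.
Proof.
move=> xs e0.
have [n _ ne] : \forall n \near \oo,
    norm2 x ^+ 2 - e ^+ 2 < \sum_(0 <= i < n) (x i : R) ^+ 2.
  have : cvgn (series (fun n => (x n : R) ^+ 2)) by [].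
  move=> /cvgrPdist_lt/(_ (e ^+ 2) (exprn_gt0 _ e0)) [n _ Hn].
  exists n => // m /Hn/=; rewrite -sqr_norm2// => /ltr_normlW.
  by rewrite /series/= ltrBlDr addrC -ltrBlDr.
have {}ne := ne n (leqnn n).
exists n; apply: norm2_le => [|m]; first exact: ltW.
apply: (@le_trans _ _ (norm2 x ^+ 2 - \sum_(0 <= i < n) (x i : R) ^+ 2)).
  (* The tail and the truncation have disjoint supports, so their squares add up coordinatewise to
     those of [x]; [maxn m n] is a common range for both sums. *)
  rewrite lerBrDr; apply: le_trans (sum_sqr_le_norm2 (maxn m n) xs).
  have -> : \sum_(0 <= i < n) (x i : R) ^+ 2 =
      \sum_(0 <= i < maxn m n) (trunc n x i : R) ^+ 2.
    rewrite (big_cat_nat (leq0n _) (leq_maxr m n))//=.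
    rewrite [X in _ + X]big_nat [X in _ + X]big1.
      by rewrite addr0; apply: eq_big_nat => i /andP[_ ni]; rewrite /trunc ni.
    by move=> i /andP[ni _]; rewrite /trunc ltnNge ni expr0n.
  apply: (@le_trans _ _ (\sum_(0 <= i < maxn m n)
      ((x - trunc n x) i : R) ^+ 2 +
      \sum_(0 <= i < maxn m n) (trunc n x i : R) ^+ 2)).
    rewrite lerD2r [leRHS](big_cat_nat (leq0n _) (leq_maxl m n))//= lerDl.
    by apply: sumr_ge0 => i _; exact: sqr_ge0.
  rewrite -big_split/=; apply: ler_sum => i _.
  rewrite -[(x - trunc n x) i]/((x i : R) - trunc n x i) /trunc.
  by case: ifP; rewrite ?subrr ?subr0 expr0n/= ?add0r ?addr0.
lra.
Qed.

Lemma square_summable_sum (I : Type) (r : seq I) (a : I -> R) (y : I -> seqs) :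
  (forall i, square_summable (y i)) ->
  square_summable (\sum_(i <- r) a i *: y i).
Proof.
move=> ys; elim/big_rec: _ => [|i u _ us]; first exact: square_summable0.
by apply: square_summableD => //; exact: square_summableZ.
Qed.

Lemma dot_suml (I : Type) (r : seq I) (a : I -> R) (y : I -> seqs) z :
  (forall i, square_summable (y i)) -> square_summable z ->
  dot (\sum_(i <- r) a i *: y i) z = \sum_(i <- r) a i * dot (y i) z.
Proof.
move=> ys zs; elim: r => [|i r IHr].
  by rewrite !big_nil /dot (@lim_series_finite _ _ 0) ?big_geq// => m _;
    exact: mul0r.
by rewrite !big_cons dot_linearl ?IHr//; exact: square_summable_sum.
Qed.

Lemma norm2_orthonormal n (a : 'I_n -> R) (y : 'I_n -> seqs) :
  (forall i, square_summable (y i)) ->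
  (forall i j, dot (y i) (y j) = (i == j)%:R) ->
  norm2 (\sum_(i < n) a i *: y i) = Num.sqrt (\sum_(i < n) a i ^+ 2).
Proof.
move=> ys yy; rewrite -[LHS]ger0_norm ?norm2_ge0// -sqrtr_sqr.
congr Num.sqrt; rewrite -dotxx; last exact: square_summable_sum.
rewrite dot_suml//; last exact: square_summable_sum.
apply: eq_bigr => i _; rewrite dotC dot_suml// (bigD1 i)//= yy eqxx mulr1.
rewrite big1 ?addr0 ?expr2// => j /negbTE ji.
by rewrite yy ji mulr0.
Qed.

End Dot.

(** * The Kalton-Peck map *)

Section KaltonPeckMap.
Context {R : realType}.
Local Notation seqs := (@seq_space R).
Implicit Types (x y z w : seqs) (a b c A B M t u : R).

(* Locked, since rewriting with lemmas about products would unfold it. *)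
Definition kpc : R := locked (2 * expR (- 2^-1)).

(** One coordinate of [KP] with the norm as a free parameter [A], so that the same coordinate can be
    compared under different normalizations. *)
Definition kpf A t : R := kpc * (Num.floor (ln (`|t| / A)))%:~R * t.

Lemma KPE x m : KP R x m = kpf (norm2 x) (x m).
Proof. by rewrite /kpf /kpc -lock. Qed.

Lemma kpc_gt0 : 0 < kpc.
Proof. by rewrite /kpc -lock mulr_gt0 ?expR_gt0. Qed.

Lemma kpf0 A : kpf A 0 = 0.
Proof. by rewrite /kpf mulr0. Qed.

Lemma kpfM a A t : a != 0 -> kpf (`|a| * A) (a * t) = a * kpf A t.
Proof.
by move=> a0; rewrite /kpf normrM -mulf_div divff ?normr_eq0// mul1r mulrCA.
Qed.

Lemma KPZ a x : square_summable x -> KP R (a *: x) = a *: KP R x.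
Proof.
move=> xs; apply/funext => m; rewrite -[RHS]/(a * (KP R x m : R)).
rewrite !KPE norm2Z// -[(a *: x) m]/(a * (x m : R)).
by have [->|a0] := eqVneq a 0; [rewrite !mul0r kpf0|rewrite kpfM].
Qed.

Lemma seq0E i : (0 : seqs) i = 0 :> R.
Proof. by []. Qed.

Lemma KP0 : KP R 0 = 0.
Proof.
rewrite -[0 in LHS](scale0r 0) KPZ ?scale0r//; exact: square_summable0.
Qed.

(** This is [ln (1 + s) <= s] at [s = a / b - 1]. *)
Lemma mul_ln_sub_le a b : 0 < a -> 0 < b -> b * (ln a - ln b) <= a - b.
Proof.
move=> a0 b0; rewrite -ln_div ?posrE//.
have /le_ln1Dx : -1 < a / b - 1 by rewrite ltrBrDr addNr divr_gt0.
rewrite addrC subrK -(ler_pM2l b0) => /le_trans; apply.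
by rewrite mulrBr mulr1 mulrCA divff ?mulr1// gt_eqF.
Qed.

Lemma mul_norm_ln_sub_le a b : 0 < a -> 0 < b ->
  a * b * `|ln a - ln b| <= a ^+ 2 + b ^+ 2.
Proof.
wlog le_ba : a b / ln b <= ln a => [wl|] a0 b0.
  have [/wl|/ltW /wl] := leP (ln b) (ln a); first exact.
  by rewrite distrC (mulrC b) (addrC (b ^+ 2)); exact.
rewrite ger0_norm ?subr_ge0// -mulrA.
have := ler_wpM2l (ltW a0) (mul_ln_sub_le a0 b0).
by move/le_trans; apply; nra.
Qed.

Lemma floor_bounds t :
  t - 1 < (Num.floor t)%:~R /\ (Num.floor t)%:~R <= t.
Proof.
by rewrite floor_le ltrBlDr; split=> //; have := floorD1_gt t; rewrite intrD.
Qed.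

(** With [a = |t| / A] and [b = |u| / B], the left side is [kpc A B a b] times the distance of the
    two floors, which is at most [1 + |ln a - ln b|]. The factor 3/2 is 1/2 from
    [a b <= (a^2 + b^2) / 2] plus 1 from the logarithmic inequality. *)
Lemma kpf_symplectic A B t u : 0 < A -> 0 < B ->
  `|kpf A t * u - t * kpf B u| <=
  kpc * A * B * (3 / 2) * ((t / A) ^+ 2 + (u / B) ^+ 2).
Proof.
move=> A0 B0; have c0 := kpc_gt0.
have pos : 0 <= kpc * A * B * (3 / 2) * ((t / A) ^+ 2 + (u / B) ^+ 2).
  apply: mulr_ge0; last by rewrite addr_ge0 ?sqr_ge0.
  have h : 0 < 3 / 2 :> R by lra.
  by apply/ltW; do 3 apply: mulr_gt0 => //.
have [t0|t0] := eqVneq t 0.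
  by apply: le_trans pos; rewrite t0 kpf0 !mul0r subrr normr0.
have [u0|u0] := eqVneq u 0.
  by apply: le_trans pos; rewrite u0 kpf0 !mulr0 subrr normr0.
have a0 : 0 < `|t| / A by rewrite divr_gt0 ?normr_gt0.
have b0 : 0 < `|u| / B by rewrite divr_gt0 ?normr_gt0.
have := mul_norm_ln_sub_le a0 b0.
rewrite /kpf; set a := `|t| / A in a0 *; set b := `|u| / B in b0 *.
have [fa1 fa2] := floor_bounds (ln a); have [fb1 fb2] := floor_bounds (ln b).
set fa := (Num.floor (ln a))%:~R : R in fa1 fa2 *.
set fb := (Num.floor (ln b))%:~R : R in fb1 fb2 *.
move=> ab.
have -> : kpc * fa * t * u - t * (kpc * fb * u) = kpc * (fa - fb) * (t * u).
  by ring.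
have sqE (v V : R) : (v / V) ^+ 2 = (`|v| / V) ^+ 2.
  by rewrite !expr_div_n real_normK ?num_real.
rewrite sqE (sqE u) !normrM (gtr0_norm c0).
have -> : `|t| = a * A by rewrite /a divfK ?gt_eqF.
have -> : `|u| = b * B by rewrite /b divfK ?gt_eqF.
rewrite !mulfK ?gt_eqF//.
have fab : `|fa - fb| <= 1 + `|ln a - ln b|.
  rewrite ler_norml; have := ler_norm (ln a - ln b).
  by have := ler_norm (- (ln a - ln b)); rewrite normrN => ? ?; apply/andP; lra.
have ab0 : 0 < a * b by rewrite mulr_gt0.
have fab2 := ler_wpM2l (ltW ab0) fab.
have h : a * b * `|fa - fb| <= 3 / 2 * (a ^+ 2 + b ^+ 2).
  apply: (le_trans fab2); rewrite mulrDr mulr1.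
  by have := sqr_ge0 (a - b); rewrite sqrrB; lra.
have cAB : 0 < kpc * A * B by rewrite !mulr_gt0.
have := ler_wpM2l (ltW cAB) h; lra.
Qed.

(** The coordinatewise estimate is summed: each normalized sequence has square sum at most 1, whence
    [3 = 3/2 (1 + 1)]. *)
Lemma KP_symplectic x y n : square_summable x -> square_summable y ->
  \sum_(0 <= i < n) `|(KP R x i : R) * y i - (x i : R) * KP R y i| <=
  3 * kpc * norm2 x * norm2 y.
Proof.
move=> xs ys.
have [x0|/eqP/(norm2_gt0 xs) x0] := eqVneq x 0.
  rewrite big1 => [|i _]; first by rewrite x0 norm2_0 mulr0 mul0r.
  by rewrite x0 KP0 !seq0E !mul0r subrr normr0.
have [y0|/eqP/(norm2_gt0 ys) y0] := eqVneq y 0.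
  rewrite big1 => [|i _]; first by rewrite y0 norm2_0 mulr0.
  by rewrite y0 KP0 !seq0E !mulr0 subrr normr0.
apply: (@le_trans _ _ (\sum_(0 <= i < n)
   kpc * norm2 x * norm2 y * (3 / 2) *
     (((x i : R) / norm2 x) ^+ 2 + ((y i : R) / norm2 y) ^+ 2))).
  by apply: ler_sum => i _; rewrite !KPE; exact: kpf_symplectic.
have nrm (v : seqs) : square_summable v -> 0 < norm2 v ->
    \sum_(0 <= i < n) ((v i : R) / norm2 v) ^+ 2 <= 1.
  move=> vs v0; under eq_bigr do rewrite expr_div_n.
  rewrite -mulr_suml ler_pdivrMr ?exprn_gt0// mul1r.
  exact: sum_sqr_le_norm2.
rewrite -mulr_sumr big_split/=.
have cAB : 0 < kpc * norm2 x * norm2 y * (3 / 2).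
  by rewrite !mulr_gt0 ?invr_gt0 ?kpc_gt0.
have := ler_wpM2l (ltW cAB) (lerD (nrm _ xs x0) (nrm _ ys y0)); lra.
Qed.

(** At scale [M] the map [kpf A] is close to the linear map [u |-> kpc ln M u], because
    [|u| (ln M - ln |u|) <= M - |u|]. The alternative [u = 0] covers the coordinates of the zero
    sequence, where [A = 0]. *)
Lemma kpf_near A M u : 0 < A \/ u = 0 -> `|u| <= M ->
  `|kpf A u - kpc * ln M * u| <= kpc * (2 + `|ln A|) * M.
Proof.
move=> Au uM; have c0 := kpc_gt0.
have M0 : 0 <= M by exact: le_trans uM.
have [u0|u0] := eqVneq u 0.
  rewrite u0 kpf0 mulr0 subrr normr0 mulr_ge0// mulr_ge0 ?(ltW c0)//.
  by rewrite addr_ge0.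
case: Au => [A0|/eqP]; last by rewrite (negPf u0).
have nu0 : 0 < `|u| by rewrite normr_gt0.
rewrite /kpf ln_div ?posrE//.
have [f1 f2] := floor_bounds (ln `|u| - ln A).
set f := (Num.floor _)%:~R : R in f1 f2 *.
have -> : kpc * f * u - kpc * ln M * u = kpc * ((f - ln M) * u) by ring.
rewrite normrM (gtr0_norm c0) -mulrA ler_pM2l// normrM.
have M1 : 0 < M by exact: lt_le_trans uM.
have l1 : ln `|u| <= ln M by rewrite ler_ln ?posrE.
have l2 := mul_ln_sub_le M1 nu0.
have fM : `|f - ln M| <= 1 + `|ln A| + (ln M - ln `|u|).
  rewrite ler_norml; have := ler_norm (ln A).
  by have := ler_norm (- ln A); rewrite normrN => ? ?; apply/andP; lra.
have := ler_wpM2r (ltW nu0) fM.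
have lA := ler_wpM2l (normr_ge0 (ln A)) uM.
by move=> h; apply: (le_trans h); lra.
Qed.

(** In coordinate [m] all three terms are compared with linear maps at the common scale
    [M = |x_m| + |y_m|]. The linear parts cancel and leave an error of at most [C M], where [C]
    depends on the norms of [x], [y] and [x + y]. *)
Lemma square_summable_KPD x y : square_summable x -> square_summable y ->
  square_summable (KP R (x + y) - KP R x - KP R y).
Proof.
move=> xs ys; have xys := square_summableD xs ys.
pose abs (v : seqs) : seqs := fun m => `|v m : R|.
have abss v : square_summable v -> square_summable (abs v).
  by move=> vs; apply: (square_summable_le (c := 1) vs) => m;
    rewrite /abs normr_id mul1r.
pose C := kpc * (2 + `|ln (norm2 (x + y))|) + kpc * (2 + `|ln (norm2 x)|)
   + kpc * (2 + `|ln (norm2 y)|).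
apply: (@square_summable_le _ _ (abs x + abs y) C).
  by apply: square_summableD; exact: abss.
move=> m; pose M := `|x m : R| + `|y m : R|.
have -> : `|(abs x + abs y) m : R| = M.
  by rewrite -[(abs x + abs y) m]/M ger0_norm// addr_ge0.
have z0 v : square_summable v -> 0 < norm2 v \/ (v m : R) = 0.
  move=> vs; have [->|/eqP/(norm2_gt0 vs)] := eqVneq v 0; first by right.
  by left.
have h1 : `|(x + y) m : R| <= M by exact: ler_normD.
have h2 : `|x m : R| <= M by rewrite lerDl.
have h3 : `|y m : R| <= M by rewrite lerDr.
have := kpf_near (z0 _ xys) h1.
have := kpf_near (z0 _ xs) h2.
have := kpf_near (z0 _ ys) h3.
rewrite -!KPE -[(KP R (x + y) - _ - _) m]/
  ((KP R (x + y) m : R) - KP R x m - KP R y m).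
rewrite -[(x + y) m]/((x m : R) + y m).
move: (KP R (x + y) m : R) (KP R x m : R) (KP R y m : R) => p q r k3 k2 k1.
have -> : p - q - r = (p - kpc * ln M * ((x m : R) + y m))
   - (q - kpc * ln M * (x m : R)) - (r - kpc * ln M * (y m : R)) by ring.
apply: (le_trans (ler_normB _ _)); rewrite /C !mulrDl lerD//.
by apply: (le_trans (ler_normB _ _)); rewrite lerD// -mulrDl.
Qed.

(** The only nonzero coordinate contributes [ln 1 = 0]. Hence the pairs [(0, unit_seq n)] belong to
    [Z2]. *)
Lemma KP_unit_seq n : KP R (unit_seq n) = 0.
Proof.
apply/funext => m; rewrite KPE.
have b1 : norm2 (@unit_seq R n) = 1.
  have bs := @square_summable_unit_seq R n.
  apply/eqP; rewrite -(@eqrXn2 _ 2)// ?norm2_ge0// expr1n.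
  rewrite -dotxx// dot_unit_seqr.
  by rewrite /unit_seq eqxx.
rewrite b1 /kpf /unit_seq; case: eqVneq => _; last by rewrite mulr0.
by rewrite normr1 divr1 ln1 floor0 mulr0 mul0r.
Qed.

End KaltonPeckMap.

(** * Linear maps and duals of quasi-normed spaces *)

Section LinearMaps.
Context {R : realType}.
Implicit Types X Y : qnSpace R.

(** These properties carry the equivalence of continuity and boundedness for linear maps, and they
    pass to subspaces. *)
Definition homogeneous X : Prop := [/\ Defs.subspace (@car R X),
  forall a x, @car R X x -> qn (a *: x) = `|a| * qn x &
  forall x, @car R X x -> 0 <= qn x].

Lemma homogeneous_induced X W :
  homogeneous X -> Defs.subspace W -> homogeneous (@induced R X W).
Proof.
move=> [_ XZ X0] [WX W0 WD].
by split=> [|a x /WX|x /WX]; [by split|exact: XZ|exact: X0].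
Qed.

Section LinearMap.
Variables (X Y : qnSpace R) (T : amb X -> amb Y).
Hypotheses (sX : Defs.subspace (@car R X)) (lT : linear_map T).

Lemma linear_map0 : T 0 = 0.
Proof.
have [_ c0 _] := sX.
have := lT.2 (-1) 0 0 c0 c0.
by rewrite scaler0 addr0 scaleN1r addNr.
Qed.

Lemma linear_mapZ a x : car x -> T (a *: x) = a *: T x.
Proof.
have [_ c0 _] := sX.
by move=> cx; rewrite -[a *: x]addr0 lT.2// linear_map0 addr0.
Qed.

Lemma car_sub x y : car x -> car y -> @car R X (y - x).
Proof.
have [_ _ cD] := sX.
by move=> cx cy; rewrite addrC -scaleN1r; exact: cD.
Qed.

Lemma linear_mapB x y : car x -> car y -> T (y - x) = T y - T x.
Proof. by move=> cx cy; rewrite addrC -scaleN1r lT.2// scaleN1r addrC. Qed.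

Lemma car_sum (I : Type) (r : seq I) (a : I -> R) (p : I -> amb X) :
  (forall i, car (p i)) -> @car R X (\sum_(i <- r) a i *: p i).
Proof.
have [_ c0 cD] := sX.
by move=> cp; elim/big_rec: _ => // i u _ cu; exact: cD.
Qed.

Lemma linear_map_sum (I : Type) (r : seq I) (a : I -> R) (p : I -> amb X) :
  (forall i, car (p i)) ->
  T (\sum_(i <- r) a i *: p i) = \sum_(i <- r) a i *: T (p i).
Proof.
move=> cp; elim: r => [|i r IHr]; first by rewrite !big_nil linear_map0.
by rewrite !big_cons lT.2// ?IHr//; exact: car_sum.
Qed.

Lemma continuous_bounded : homogeneous X -> homogeneous Y -> continuous_map T ->
  exists2 K, 0 < K & forall x, car x -> qn (T x) <= K * qn x.
Proof.
have [_ c0 cD] := sX => -[_ XZ X0] [_ YZ _] /(_ 0 c0 1 ltr01)[d d0 dT].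
exists d^-1 => [|x cx]; first by rewrite invr_gt0.
apply/ler_addgt0Pr => e e0.
(* The slack [d * e] keeps the divisor positive even if [qn x = 0]. Scaling [x] by [t] brings it
   within [d] of 0, which yields the bound [qn x / d + e] for every [e > 0]. *)
have r0 : 0 < qn x + d * e.
  by rewrite ltr_wpDl ?X0// mulr_gt0.
pose t := d / (qn x + d * e).
have t0 : 0 < t by rewrite divr_gt0.
have ctx : car (t *: x) by rewrite -[t *: x]addr0; exact: cD.
have := dT (t *: x) ctx; rewrite linear_map0 !subr0 XZ// linear_mapZ// YZ//;
  last exact: lT.1.
rewrite (gtr0_norm t0) => h.
have /h {}h : t * qn x < d.
  rewrite /t -mulrA gtr_pMr// mulrC ltr_pdivrMr// mul1r ltrDl.
  exact: mulr_gt0.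
rewrite -(ler_pM2l t0); apply: (le_trans (ltW h)).
have -> : d^-1 * qn x + e = d^-1 * (qn x + d * e).
  by rewrite mulrDr mulrA mulVf ?mul1r// gt_eqF.
by rewrite /t mulrACA mulfV ?mulVf ?mulr1// gt_eqF.
Qed.

Lemma bounded_continuous K : (forall x, @car R X x -> 0 <= qn x) -> 0 <= K ->
  (forall x, car x -> qn (T x) <= K * qn x) -> continuous_map T.
Proof.
move=> X0 K0 KT x cx e e0.
have K1 : 0 < K + 1 by rewrite ltr_wpDl.
exists (e / (K + 1)) => [|y cy]; first by rewrite divr_gt0.
rewrite ltr_pdivlMr// -linear_mapB// mulrC; apply: le_lt_trans.
have cyx := car_sub cx cy; apply: (le_trans (KT _ cyx)).
by rewrite ler_wpM2r ?X0// lerDl.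
Qed.

End LinearMap.


Lemma homogeneous_scalars : homogeneous (@scalars R).
Proof. by split=> //= a x _; exact: normrM. Qed.

Lemma homogeneous_ell2 : homogeneous (ell2 R).
Proof.
split=> [|a x /= xs|x _]; [split=> //=|exact: norm2Z|exact: norm2_ge0].
  exact: square_summable0.
by move=> a x y xs ys; apply: square_summableD => //; exact: square_summableZ.
Qed.

(** * The dual quasi-norm *)

Section Dual.
Variable X : qnSpace R.
Hypothesis hX : homogeneous X.
Implicit Types (f g : amb (dual X)) (c : R).

Let sX : Defs.subspace (@car R X). Proof. by have [] := hX. Qed.
Let X0 x : @car R X x -> 0 <= qn x. Proof. by have [_ _] := hX; exact. Qed.

Lemma car_dual f c : @linear_map R X scalars f -> 0 <= c ->
  (forall x, @car R X x -> `|f x : R| <= c * qn x) ->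
  (forall x, ~ @car R X x -> f x = 0) -> @car R (dual X) f.
Proof.
by move=> lf c0 fc f0; split=> //; exact: (bounded_continuous sX lf X0 c0 fc).
Qed.

Let dual_set f := [set `|f x : R| | x in [set x | @car R X x /\ qn x <= 1]].

Let dual_set0 f : @car R (dual X) f -> dual_set f 0.
Proof.
have [_ c0 _] := sX; have [_ XZ _] := hX => -[lf _ _]; exists 0.
  by split=> //; rewrite -(scale0r 0) XZ// normr0 mul0r.
by rewrite (linear_map0 sX lf) normr0.
Qed.

Let has_sup_dual_set f : @car R (dual X) f -> has_sup (dual_set f).
Proof.
move=> cf; split; first by exists 0; exact: dual_set0.
have [lf kf _] := cf.
have [K K0 fK] := continuous_bounded sX lf hX homogeneous_scalars kf.
exists K => _ [x [cx x1] <-]; apply: (le_trans (fK x cx)).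
by rewrite ler_piMr// ltW.
Qed.

Lemma dual_norm_ge0 f : @car R (dual X) f -> 0 <= qn f.
Proof.
move=> cf; apply: sup_upper_bound; first exact: has_sup_dual_set.
exact: dual_set0.
Qed.

Lemma dual_norm_bound f x :
  @car R (dual X) f -> @car R X x -> `|f x : R| <= qn f * qn x.
Proof.
move=> cf cx; have [lf kf _] := cf; have [_ XZ _] := hX.
have [K K0 fK] := continuous_bounded sX lf hX homogeneous_scalars kf.
(* A vector of quasi-norm 0 cannot be normalized; there boundedness of [f] already forces
   [f x = 0]. *)
have := X0 cx; rewrite le0r => /orP[/eqP x0|x0].
  by rewrite x0 mulr0; apply: le_trans (fK x cx) _; rewrite x0 mulr0.
rewrite -ler_pdivrMr//; apply: sup_upper_bound; first exact: has_sup_dual_set.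
exists ((qn x)^-1 *: x).
  split; last by rewrite XZ// gtr0_norm ?invr_gt0// mulVf// gt_eqF.
  by have [_ c0 cD] := sX; rewrite -[_ *: _]addr0; exact: cD.
rewrite (linear_mapZ sX lf)// -[_ *: _]/((qn x)^-1 * (f x : R)) normrM mulrC.
by rewrite (@gtr0_norm _ (qn x)^-1)// invr_gt0.
Qed.

Lemma dual_norm_le f c : @car R (dual X) f -> 0 <= c ->
  (forall x, @car R X x -> `|f x : R| <= c * qn x) -> qn f <= c.
Proof.
move=> cf c0 fc; apply: ge_sup; first by exists 0; exact: dual_set0.
by move=> _ [x [cx x1] <-]; apply: (le_trans (fc x cx)); rewrite ler_piMr.
Qed.

Lemma subspace_dual : Defs.subspace (@car R (dual X)).
Proof.
have [_ c0 cD] := sX.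
split=> // [|a f g cf cg].
  apply: (@car_dual _ 0) => // [|x _]; last by rewrite mul0r normr0.
  by split=> // b x y _ _; rewrite scaler0 addr0.
have [[lf _ f0] [lg _ g0]] := (cf, cg).
have E x : (a *: f + g) x = a * (f x : R) + g x by [].
apply: (@car_dual _ (`|a| * qn f + qn g)).
- split=> // b x y cx cy; rewrite !E lf.2// lg.2//.
  rewrite -[b *: f x]/(b * (f x : R)) -[b *: g x]/(b * (g x : R)).
  rewrite -[b *: (_ + _)]/(b * (a * (f x : R) + g x)); ring.
- by rewrite addr_ge0 ?mulr_ge0 ?dual_norm_ge0.
- move=> x cx; rewrite E; apply: le_trans (ler_normD _ _) _.
  rewrite normrM mulrDl -mulrA lerD ?ler_wpM2l//; exact: dual_norm_bound.
- by move=> x cx; rewrite E f0// g0// mulr0 addr0.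
Qed.

End Dual.

End LinearMaps.

(** * Self-duality of the Kalton-Peck space *)

Section KaltonPeckSpace.
Context {R : realType}.
Implicit Types (w z : amb (Z2 R)) (a b : R).

Lemma homogeneous_Z2 : homogeneous (Z2 R).
Proof.
split=> [|a x [/= x2 x1]|x _]; last by rewrite addr_ge0 ?norm2_ge0.
  split=> //=; first by rewrite KP0 subrr; split; exact: square_summable0.
  move=> a x y [x2 x1] [y2 y1].
  have ax2 := square_summableZ (a := a) x2.
  split; first exact: square_summableD.
  (* The residual of the combination is the combination of the residuals, corrected by the failure
     of additivity of [KP], which is square summable. *)
  have -> : (a *: x + y).1 - KP R (a *: x + y).2 =
      a *: (x.1 - KP R x.2) + (y.1 - KP R y.2) -
      (KP R (a *: x.2 + y.2) - KP R (a *: x.2) - KP R y.2).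
    rewrite KPZ// scalerBr /=.
    set p := a *: x.1; set q := a *: KP R x.2; set r := KP R (_ + _).
    by apply/funext => m; rewrite !fctE; ring.
  apply: square_summableB; last exact: square_summable_KPD.
  by apply: square_summableD => //; exact: square_summableZ.
rewrite KPZ// -scalerBr norm2Z//.
by rewrite mulrDr; congr (_ + _); exact: norm2Z.
Qed.

(** The alternating form [B] that identifies [Z2] with its dual. *)
Definition symp w z : R :=
  limn (series (fun n => (w.1 n : R) * z.2 n - (w.2 n : R) * z.1 n)).

(** Splitting each first coordinate into its residual and its [KP] part gives two Cauchy-Schwarz
    terms and the antisymmetric term of [KP_symplectic]. Each term of the bound contains the norm of
    a second coordinate, which is exploited in the proof of (3). *)
Lemma cvg_symp w z : car w -> car z ->
  cvgn (series (fun n => (w.1 n : R) * z.2 n - (w.2 n : R) * z.1 n)) /\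
  `|symp w z| <= norm2 (w.1 - KP R w.2) * norm2 z.2 +
    norm2 w.2 * norm2 (z.1 - KP R z.2) + 3 * kpc * norm2 w.2 * norm2 z.2.
Proof.
move=> [/= w2 w1] [/= z2 z1]; apply: cvg_series_norm_le => n.
apply: (@le_trans _ _ (\sum_(0 <= i < n)
  (`|((w.1 - KP R w.2) i : R) * z.2 i| + `|(w.2 i : R) * (z.1 - KP R z.2) i| +
   `|(KP R w.2 i : R) * z.2 i - (w.2 i : R) * KP R z.2 i|))).
  apply: ler_sum => i _.
  have -> : (w.1 i : R) * z.2 i - (w.2 i : R) * z.1 i =
      (w.1 - KP R w.2) i * z.2 i + - ((w.2 i : R) * (z.1 - KP R z.2) i) +
      ((KP R w.2 i : R) * z.2 i - (w.2 i : R) * KP R z.2 i).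
    by rewrite !fctE; ring.
  apply: (le_trans (ler_normD _ _)); rewrite lerD2r.
  by apply: (le_trans (ler_normD _ _)); rewrite normrN.
rewrite !big_split/=; apply: lerD; last exact: KP_symplectic.
by apply: lerD; apply: sum_norm_mul_le; rewrite ?norm2_ge0//;
  exact: sum_sqr_le_norm2.
Qed.

Lemma symp_le w z : car w -> car z ->
  `|symp w z| <= (2 + 3 * kpc) * qn w * qn z.
Proof.
move=> cw cz; apply: (le_trans (cvg_symp cw cz).2); rewrite /qn/=.
have c0 := @kpc_gt0 R.
set p := norm2 (w.1 - _); set q := norm2 w.2.
set r := norm2 (z.1 - _); set s := norm2 z.2.
have [p0 q0 r0 s0] : [/\ 0 <= p, 0 <= q, 0 <= r & 0 <= s].
  by split; exact: norm2_ge0.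
have c3 : 0 <= 3 * @kpc R by lra.
move: (3 * _) c3 => c c3.
have [pr ps qr qs] : [/\ 0 <= p * r, 0 <= p * s, 0 <= q * r & 0 <= q * s].
  by split; exact: mulr_ge0.
have := mulr_ge0 c3 pr; have := mulr_ge0 c3 ps; have := mulr_ge0 c3 qr.
have := mulr_ge0 c3 qs; lra.
Qed.

Lemma symp_linearl a w w' z : car w -> car w' -> car z ->
  symp (a *: w + w') z = a * symp w z + symp w' z.
Proof.
move=> cw cw' cz; rewrite /symp.
rewrite -lim_series_linear; [|exact: (cvg_symp _ _).1..].
congr (limn (series _)); apply/funext => n /=.
by rewrite -[(a *: _ + _) n]/(a * (w.1 n : R) + w'.1 n)
  -[(a *: w.2 + _) n]/(a * (w.2 n : R) + w'.2 n); ring.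
Qed.

Lemma sympC w z : car w -> car z -> symp w z = - symp z w.
Proof.
move=> cw cz; rewrite /symp -limN//; last exact: (cvg_symp _ _).1.
congr (limn _); apply/funext => n; rewrite /series/= -[RHS]sumrN.
by apply: eq_bigr => i _; ring.
Qed.

Lemma symp_linearr a w z z' : car w -> car z -> car z' ->
  symp w (a *: z + z') = a * symp w z + symp w z'.
Proof.
have [[_ _ cD] _ _] := homogeneous_Z2.
move=> cw cz cz'; rewrite sympC//; last exact: cD.
by rewrite symp_linearl// opprD -mulrN -!sympC.
Qed.

End KaltonPeckSpace.

(** * Representation of functionals by the alternating form *)

Section SelfDuality.
Context {R : realType}.
Local Notation seqs := (@seq_space R).
Implicit Types (w z : amb (Z2 R)) (f g h : amb (dual (Z2 R))) (x y v t : seqs).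

Lemma trunc_id n x : (forall m, (n <= m)%N -> x m = 0) -> trunc n x = x.
Proof.
by move=> x0; apply/funext => m; rewrite /trunc; case: ltnP => // /x0.
Qed.

Lemma KP_trunc n x : trunc n (KP R (trunc n x)) = KP R (trunc n x).
Proof.
by apply: trunc_id => m nm; rewrite KPE /trunc ltnNge nm kpf0.
Qed.

Lemma sum_pairs (r : seq nat) (a : nat -> R) (p q : nat -> seqs) :
  \sum_(i <- r) a i *: ((p i, q i) : amb (Z2 R)) =
  (\sum_(i <- r) a i *: p i, \sum_(i <- r) a i *: q i).
Proof.
by elim: r => [|i r IHr]; [rewrite !big_nil|rewrite !big_cons IHr].
Qed.

(** The partial sum is the square of [N = norm2 (trunc n v)], so the hypothesis reads [N^2 <= c N]
    and gives [N <= c] uniformly in [n]. It is the usual way to bound a sequence by testing a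
    functional on its own truncations. *)
Lemma square_summable_self_bound v c : 0 <= c ->
  (forall n, \sum_(0 <= i < n) (v i : R) ^+ 2 <= c * norm2 (trunc n v)) ->
  square_summable v /\ norm2 v <= c.
Proof.
move=> c0 vc.
have h n : \sum_(0 <= i < n) (v i : R) ^+ 2 <= c ^+ 2.
  have [_ E] := square_summable_trunc n v.
  have N0 := norm2_ge0 (trunc n v).
  move: (vc n); rewrite -E => NN.
  rewrite ler_sqr ?nnegrE//.
  move: N0; rewrite le0r => /orP[/eqP->//|N0].
  by rewrite -(ler_pM2r N0) -expr2.
by split; [exact: square_summable_bounded h|exact: norm2_le].
Qed.

(** Finite combinations of unit vectors are dense: [g x] equals [g] of every tail of [x], and the
    tails tend to 0. *)
Lemma functional_eq0 (g : amb (ell2 R) -> R^o) c :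
  @linear_map R (ell2 R) scalars g ->
  (forall x, square_summable x -> `|g x : R| <= c * norm2 x) -> 0 <= c ->
  (forall n, g (unit_seq n) = 0) -> forall x, square_summable x -> g x = 0.
Proof.
move=> lg gc c0 g0 x xs; have [sX _ _] := @homogeneous_ell2 R.
have [ts _] := all_and2 (fun n => square_summable_trunc n x).
have gx n : g x = g (x - trunc n x).
  rewrite (linear_mapB lg (ts n) xs) trunc_unit_seq (linear_map_sum sX lg).
    by rewrite big1 ?subr0// => i _; rewrite g0 scaler0.
  exact: square_summable_unit_seq.
apply/eqP; rewrite -normr_le0; apply/ler_addgt0Pr => e e0.
have c1 : 0 < c + 1 by rewrite ltr_wpDl.
have ec : 0 < e / (c + 1) by rewrite divr_gt0.
have [n ne] := norm2_tail_small xs ec.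
rewrite add0r (gx n); apply: le_trans (gc _ (square_summableB xs (ts n))) _.
apply: (le_trans (ler_wpM2l c0 ne)).
by rewrite mulrCA ger_pMr// ler_pdivrMr// mul1r lerDl.
Qed.

Lemma car_inl x : square_summable x -> @car R (Z2 R) (x, 0).
Proof. by split; rewrite /= ?KP0 ?subr0//; exact: square_summable0. Qed.

Lemma qn_inl x : qn ((x, 0) : amb (Z2 R)) = norm2 x.
Proof. by rewrite /= KP0 subr0 norm2_0 addr0. Qed.

Lemma car_KP y : square_summable y -> @car R (Z2 R) (KP R y, y).
Proof. by split; rewrite //= subrr; exact: square_summable0. Qed.

Lemma qn_KP y : qn ((KP R y, y) : amb (Z2 R)) = norm2 y.
Proof. by rewrite /= subrr norm2_0 add0r. Qed.

Lemma car_inr_unit_seq n : @car R (Z2 R) (0, unit_seq n).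
Proof. by rewrite -(KP_unit_seq n); exact/car_KP/square_summable_unit_seq. Qed.

Lemma symp_inl w n : symp w (unit_seq n, 0) = - (w.2 n : R).
Proof.
rewrite /symp (@lim_series_finite _ _ n.+1) => [|m nm /=]; last first.
  by rewrite /unit_seq gtn_eqF// !mulr0 subrr.
rewrite big_nat_recr//= big_nat big1 ?add0r.
  by rewrite /unit_seq eqxx mulr0 mulr1 add0r.
by move=> i /andP[_ ni]; rewrite /unit_seq ltn_eqF// !mulr0 subrr.
Qed.

Lemma symp_inr w n : symp w (0, unit_seq n) = w.1 n.
Proof.
rewrite /symp (@lim_series_finite _ _ n.+1) => [|m nm /=]; last first.
  by rewrite /unit_seq gtn_eqF// !mulr0 subrr.
rewrite big_nat_recr//= big_nat big1 ?add0r.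
  by rewrite /unit_seq eqxx mulr0 mulr1 subr0.
by move=> i /andP[_ ni]; rewrite /unit_seq ltn_eqF// !mulr0 subrr.
Qed.

(** The value 0 off the carrier matches the representation of functionals by their extension by
    zero. *)
Definition to_dual w : amb (dual (Z2 R)) :=
  fun z => if pselect (car z) then symp w z else 0.

Definition of_dual f : amb (Z2 R) :=
  (fun n => f (0, unit_seq n), fun n => - (f (unit_seq n, 0) : R)).

Lemma to_dualE w z : car z -> to_dual w z = symp w z.
Proof. by rewrite /to_dual; case: pselect. Qed.

Lemma to_dual_out w z : ~ car z -> to_dual w z = 0.
Proof. by rewrite /to_dual; case: pselect. Qed.

Lemma symp_const_ge0 : 0 <= 2 + 3 * @kpc R.
Proof. by have := @kpc_gt0 R; lra. Qed.

Lemma car_to_dual w : car w -> car (to_dual w).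
Proof.
move=> cw; have [[_ _ cD] _ q0] := @homogeneous_Z2 R.
apply: (@car_dual _ _ homogeneous_Z2 _ ((2 + 3 * @kpc R) * qn w)).
- split=> // a x y cx cy; rewrite !to_dualE ?symp_linearr//; exact: cD.
- by rewrite mulr_ge0 ?symp_const_ge0 ?q0.
- by move=> x cx; rewrite to_dualE//; exact: symp_le.
- exact: to_dual_out.
Qed.

Lemma linear_to_dual : @linear_map R (Z2 R) (dual (Z2 R)) to_dual.
Proof.
split=> [|a w w' cw cw']; first exact: car_to_dual.
apply/funext => z; rewrite -[RHS]/(a * (to_dual w z : R) + to_dual w' z).
have [cz|cz] := pselect (car z); first by rewrite !to_dualE// symp_linearl.
by rewrite !to_dual_out// mulr0 addr0.
Qed.

Lemma to_dual_bound w : car w -> qn (to_dual w) <= (2 + 3 * kpc) * qn w.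
Proof.
move=> cw; have [_ _ q0] := @homogeneous_Z2 R.
apply: (dual_norm_le homogeneous_Z2 (car_to_dual cw)).
  by rewrite mulr_ge0 ?symp_const_ge0 ?q0.
by move=> z cz; rewrite to_dualE//; exact: symp_le.
Qed.

Lemma dual_inl_sum f n x : car f ->
  f (trunc n x, 0) = \sum_(0 <= i < n) (x i : R) * f (unit_seq i, 0) :> R.
Proof.
have [sX _ _] := @homogeneous_Z2 R; move=> [lf _ _].
have -> : (trunc n x, 0) =
    \sum_(0 <= i < n) x i *: ((unit_seq i, 0) : amb (Z2 R)).
  by rewrite sum_pairs -trunc_unit_seq big1// => i _; rewrite scaler0.
rewrite (linear_map_sum sX lf)// => i.
exact/car_inl/square_summable_unit_seq.
Qed.

Lemma dual_inr_sum f n x : car f ->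
  f (0, trunc n x) = \sum_(0 <= i < n) (x i : R) * f (0, unit_seq i) :> R.
Proof.
have [sX _ _] := @homogeneous_Z2 R; move=> [lf _ _].
have -> : (0, trunc n x) =
    \sum_(0 <= i < n) x i *: ((0, unit_seq i) : amb (Z2 R)).
  by rewrite sum_pairs -trunc_unit_seq big1// => i _; rewrite scaler0.
rewrite (linear_map_sum sX lf)// => i; exact: car_inr_unit_seq.
Qed.

(** At the test vector [(trunc n v, 0)], of quasi-norm [norm2 (trunc n v)], the functional takes the
    value minus the sum of the [v_i^2] for [i < n]. *)
Lemma of_dual_snd_bound f : car f ->
  square_summable (of_dual f).2 /\ norm2 (of_dual f).2 <= qn f.
Proof.
move=> cf; apply: square_summable_self_bound.
  exact: (dual_norm_ge0 homogeneous_Z2 cf).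
set v := (of_dual f).2 => n; have [ts _] := square_summable_trunc n v.
rewrite -qn_inl.
apply: le_trans (dual_norm_bound homogeneous_Z2 cf (car_inl ts)).
rewrite -normrN; apply: le_trans (ler_norm _).
rewrite (dual_inl_sum _ _ cf) -sumrN; apply: ler_sum => i _.
by rewrite -mulrN -expr2.
Qed.

(** The residual [r] is tested on its truncation [t]. The quasi-norm of [(0, t)] involves [KP t], so
    [(0, t)] is written as [(KP t, t) - (KP t, 0)]: the first vector has quasi-norm [norm2 t], and
    the second one completes the sum to the antisymmetric expression bounded by [KP_symplectic]. *)
Lemma of_dual_fst_bound f : car f ->
  square_summable ((of_dual f).1 - KP R (of_dual f).2) /\
  norm2 ((of_dual f).1 - KP R (of_dual f).2) <= (1 + 3 * kpc) * qn f.
Proof.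
move=> cf; have [vs vf] := of_dual_snd_bound cf.
have f0 := dual_norm_ge0 homogeneous_Z2 cf.
have c0 := @kpc_gt0 R; have [lf _ _] := cf.
set v := (of_dual f).2 in vs vf *; set u := (of_dual f).1.
apply: square_summable_self_bound; first by rewrite mulr_ge0//; lra.
move=> n; set r := u - KP R v; set t := trunc n r.
have [ts _] := square_summable_trunc n r; rewrite -/t in ts.
(* [KP t] is supported on the first [n] coordinates like [t], so [(KP t, 0)] lies in [Z2] and [f] is
   a finite sum there. *)
have [ks _] := square_summable_trunc n (KP R t); rewrite KP_trunc -/t in ks.
have f0t : f (0, t) = f (KP R t, t) - f (KP R t, 0).
  rewrite -(linear_mapB lf (car_inl ks) (car_KP ts)); congr f.
  by rewrite -[RHS]/(KP R t - KP R t, t - 0) subrr subr0.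
have E : \sum_(0 <= i < n) (r i : R) ^+ 2 = f (KP R t, t) +
    \sum_(0 <= i < n) ((KP R t i : R) * v i - (t i : R) * KP R v i).
  transitivity ((f (0, t) : R) - \sum_(0 <= i < n) (t i : R) * KP R v i).
    rewrite /t dual_inr_sum// -sumrB; apply: eq_big_nat => i /andP[_ ni].
    by rewrite /trunc ni -mulrBr expr2.
  rewrite f0t -{2}(KP_trunc n r) dual_inl_sum//.
  rewrite sumrB addrA; congr (_ - _).
  rewrite -[LHS]/((f (KP R t, t) : R) - _) -sumrN; congr (_ + _).
  by apply: eq_bigr => i _; rewrite -mulrN.
rewrite E; have b1 := dual_norm_bound homogeneous_Z2 cf (car_KP ts).
rewrite qn_KP in b1; have b2 := KP_symplectic n ts vs.
have b3 : \sum_(0 <= i < n) ((KP R t i : R) * v i - (t i : R) * KP R v i) <=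
    3 * kpc * norm2 t * norm2 v.
  by apply: le_trans b2; apply: ler_sum => i _; exact: ler_norm.
have b4 : 3 * kpc * norm2 t * norm2 v <= 3 * kpc * norm2 t * qn f.
  by apply: ler_wpM2l => //; rewrite mulr_ge0 ?norm2_ge0//; lra.
have := ler_norm (f (KP R t, t) : R); lra.
Qed.

Lemma car_of_dual f : car f -> car (of_dual f).
Proof.
by move=> cf; split; [exact: (of_dual_snd_bound cf).1|
  exact: (of_dual_fst_bound cf).1].
Qed.

Lemma linear_of_dual : @linear_map R (dual (Z2 R)) (Z2 R) of_dual.
Proof.
split=> [|a f g _ _]; first exact: car_of_dual.
congr (_, _); apply/funext => n.
by rewrite -[LHS]/(- (a * (f (unit_seq n, 0) : R) + g (unit_seq n, 0)))
  -[RHS]/(a * (- (f (unit_seq n, 0) : R)) - g (unit_seq n, 0)); ring.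
Qed.

Lemma of_dual_bound f : car f -> qn (of_dual f) <= (2 + 3 * kpc) * qn f.
Proof.
move=> cf; have [_ b2] := of_dual_snd_bound cf.
have [_ b1] := of_dual_fst_bound cf; rewrite [leLHS]/=; lra.
Qed.

Lemma to_dualK w : car w -> of_dual (to_dual w) = w.
Proof.
move=> cw; case: w cw => u v cw; congr (_, _); apply/funext => n.
  by rewrite to_dualE ?symp_inr//; exact: car_inr_unit_seq.
rewrite to_dualE ?symp_inl ?opprK//.
exact/car_inl/square_summable_unit_seq.
Qed.

(* A functional vanishing at all [(e_n, 0)] depends only on the second
   coordinate, and [(KP y, y)] is a lift of [y] of the same norm. *)
Lemma dual_eq0 h : car h -> (forall n, h (unit_seq n, 0) = 0) ->
  (forall n, h (0, unit_seq n) = 0) -> h = 0.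
Proof.
move=> ch h1 h2; have [lh _ h0] := ch.
have q0 := dual_norm_ge0 homogeneous_Z2 ch.
have [[_ _ cD] _ _] := @homogeneous_Z2 R.
have [[_ _ eD] _ _] := @homogeneous_ell2 R.
have hl x : square_summable x -> h (x, 0) = 0.
  apply: (@functional_eq0 (fun x => h (x, 0)) (qn h)) => //.
    split=> // a y z ys zs; rewrite -lh.2; [|exact: car_inl..].
    by congr h; rewrite -[RHS]/(a *: y + z, a *: 0 + 0) scaler0 addr0.
  move=> y ys; rewrite -qn_inl; apply: (dual_norm_bound homogeneous_Z2) => //.
  exact: car_inl.
have hKP u y : car ((u, y) : amb (Z2 R)) -> h (u, y) = h (KP R y, y).
  move=> cuy; have [/= ys us] := cuy; apply/eqP; rewrite -subr_eq0.
  rewrite -(linear_mapB lh (car_KP ys) cuy) -[X in h X]/(u - KP R y, y - y).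
  by rewrite subrr hl.
have hr y : square_summable y -> h (KP R y, y) = 0.
  apply: (@functional_eq0 (fun y => h (KP R y, y)) (qn h)) => //.
  (* [KP] is not additive, but [y |-> h (KP y, y)] is linear since by [hKP] the first coordinate can
     be replaced by any admissible one. *)
  - split=> // a x z xs zs; rewrite -lh.2; [|exact: car_KP..].
    apply/esym/(hKP (a *: KP R x + KP R z) (a *: x + z)).
    by apply: (cD a (KP R x, x) (KP R z, z)); exact: car_KP.
  - move=> x xs; rewrite -qn_KP; apply: (dual_norm_bound homogeneous_Z2) => //.
    exact: car_KP.
  - by move=> n; rewrite -(hKP 0 (unit_seq n)) ?h2//; exact: car_inr_unit_seq.
apply/funext => -[u y]; have [cuy|/h0//] := pselect (car ((u, y) : amb (Z2 R))).
by rewrite (hKP _ _ cuy) hr//; case: cuy.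
Qed.

Lemma of_dualK f : car f -> to_dual (of_dual f) = f.
Proof.
move=> cf; have cw := car_of_dual cf; have cg := car_to_dual cw.
apply/esym/eqP; rewrite -subr_eq0; apply/eqP; apply: dual_eq0.
- exact: (car_sub (subspace_dual homogeneous_Z2) cg cf).
- move=> n; have ce := car_inl (@square_summable_unit_seq R n).
  rewrite -[LHS]/((f _ : R) - to_dual (of_dual f) _) to_dualE//.
  by rewrite symp_inl/= opprK subrr.
- move=> n; have ce := car_inr_unit_seq n.
  rewrite -[LHS]/((f _ : R) - to_dual (of_dual f) _) to_dualE//.
  by rewrite symp_inr/= subrr.
Qed.

Lemma isomorphic_dual : isomorphic (Z2 R) (dual (Z2 R)).
Proof.
have [sX _ X0] := @homogeneous_Z2 R.
exists to_dual; split; first exact: linear_to_dual.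
  apply: (bounded_continuous sX linear_to_dual X0 symp_const_ge0).
  exact: to_dual_bound.
exists of_dual.
split; [exact: linear_of_dual| |exact: to_dualK|exact: of_dualK].
apply: (bounded_continuous (subspace_dual homogeneous_Z2) linear_of_dual _
  symp_const_ge0); last exact: of_dual_bound.
by move=> f; exact: (dual_norm_ge0 homogeneous_Z2).
Qed.

End SelfDuality.

(** * Strict singularity of the quotient map *)

Section SignAverages.
Context {R : realType} (n : nat).
Local Notation signs := {ffun 'I_n -> bool}.

Definition sgn (e : signs) (i : 'I_n) : R := (-1) ^+ e i.

Lemma sgn_neq0 e i : sgn e i != 0.
Proof. by rewrite signr_eq0. Qed.

Lemma normr_sgn e i : `|sgn e i| = 1.
Proof. exact: normr_sign. Qed.

Lemma sgnM e i : sgn e i * sgn e i = 1.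
Proof. by rewrite -expr2 sqrr_sign. Qed.

(** Orthogonality of the Rademacher functions: for distinct [i] and [j], flipping the sign at [i] is
    an involution that negates the summand. *)
Lemma sum_sgnM i j :
  \sum_e sgn e i * sgn e j = #|{: signs}|%:R * (i == j)%:R.
Proof.
have [<-|ij] := eqVneq i j.
  under eq_bigr do rewrite sgnM.
  by rewrite mulr1 sumr_const.
rewrite mulr0; set S := LHS.
pose flip (e : signs) : signs := [ffun k => (k == i) (+) e k].
have flipK : involutive flip.
  by move=> e; apply/ffunP => k; rewrite !ffunE addbA addbb.
suff : S = - S by lra.
rewrite {1}/S (reindex_inj (inv_inj flipK)) -sumrN; apply: eq_bigr => e _.
rewrite /sgn !ffunE eqxx (eq_sym j) (negbTE ij) signr_addb addFb.
by rewrite expr1 mulN1r mulNr.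
Qed.

Lemma sum_sgn_mul (a b : 'I_n -> R) :
  \sum_e (\sum_i sgn e i * a i) * (\sum_i sgn e i * b i) =
  #|{: signs}|%:R * \sum_i a i * b i.
Proof.
under eq_bigr => e _.
  rewrite mulr_suml; under eq_bigr => i _.
    by rewrite mulr_sumr; under eq_bigr do rewrite mulrACA; over.
  over.
rewrite exchange_big/= mulr_sumr; apply: eq_bigr => i _.
rewrite exchange_big/= (bigD1 i)//= -mulr_suml sum_sgnM eqxx mulr1.
rewrite big1 ?addr0// => j ji.
by rewrite -mulr_suml sum_sgnM eq_sym (negbTE ji) mulr0 mul0r.
Qed.

End SignAverages.

(** * Bound on the number of disjoint blocks *)

Section Blocks.
Context {R : realType}.
Local Notation seqs := (@seq_space R).
Implicit Types (A B D K t : R).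

(** Replacing [A] by [B] shifts the logarithm by exactly [ln B - ln A], and the two floors lose at
    most 1 together. This is the source of the logarithmic gain. *)
Lemma kpf_sub_ge A B t : 0 < A -> 0 < B ->
  kpc * t ^+ 2 * (ln B - ln A - 1) <= t * (kpf A t - kpf B t).
Proof.
move=> A0 B0; have c0 := @kpc_gt0 R.
have [->|t0] := eqVneq t 0; first by rewrite expr0n mulr0 !mul0r.
have nt : 0 < `|t| by rewrite normr_gt0.
rewrite /kpf !ln_div ?posrE//.
have [fa _] := floor_bounds (ln `|t| - ln A).
have [_ fb] := floor_bounds (ln `|t| - ln B).
set p := (Num.floor (ln `|t| - ln A))%:~R : R in fa *.
set q := (Num.floor (ln `|t| - ln B))%:~R : R in fb *.
have -> : t * (kpc * p * t - kpc * q * t) = kpc * t ^+ 2 * (p - q) by ring.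
apply: ler_wpM2l; last lra.
by apply: mulr_ge0; [exact: ltW|exact: sqr_ge0].
Qed.

Lemma sum_fst (I : Type) (r : seq I) (F : I -> amb (Z2 R)) m :
  (\sum_(i <- r) F i).1 m = \sum_(i <- r) ((F i).1 m : R).
Proof. by elim/big_rec2: _ => // i u v _ <-. Qed.

Lemma sum_snd (I : Type) (r : seq I) (F : I -> amb (Z2 R)) m :
  (\sum_(i <- r) F i).2 m = \sum_(i <- r) ((F i).2 m : R).
Proof. by elim/big_rec2: _ => // i u v _ <-. Qed.

Lemma symp_finite (w z : amb (Z2 R)) n :
  (forall m, (n <= m)%N -> z.1 m = 0 /\ z.2 m = 0) ->
  symp w z = \sum_(0 <= m < n) ((w.1 m : R) * z.2 m - (w.2 m : R) * z.1 m).
Proof.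
by move=> z0; apply: lim_series_finite => m /z0[-> ->]; rewrite !mulr0 subrr.
Qed.

Section BlockBound.
Variables (N M : nat) (p : 'I_N -> amb (Z2 R)) (z : 'I_N -> seqs) (K d : R).
Hypotheses (K0 : 0 < K) (d0 : 0 < d) (cp : forall i, car (p i))
  (pK : forall i, qn (p i) <= K)
  (psK : forall e, qn (\sum_i sgn e i *: p i) <= K * Num.sqrt N%:R)
  (zp : forall i m, z i m = 0 \/ z i m = (p i).2 m)
  (zM : forall i m, (M <= m)%N -> z i m = 0)
  (zz : forall i j m, i != j -> (z i m : R) * z j m = 0)
  (zd : forall i, d ^+ 2 <= \sum_(0 <= m < M) (z i m : R) ^+ 2).

Let c := @kpc R.
Let D2 := \sum_i \sum_(0 <= m < M) (z i m : R) ^+ 2.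
(** Since the blocks are disjoint, [D] is the norm of [w e] for every choice of signs. *)
Let D := Num.sqrt D2.
Let w (e : {ffun 'I_N -> bool}) : seqs := fun m => \sum_i sgn e i * (z i m : R).

Let D2_ge0 : 0 <= D2.
Proof. by do 2 apply: sumr_ge0 => ? _; exact: sqr_ge0. Qed.

Let DD : D ^+ 2 = D2. Proof. exact: sqr_sqrtr. Qed.

Let D2_ge : N%:R * d ^+ 2 <= D2.
Proof.
rewrite mulr_natl -[N in _ *+ N](card_ord N) -sumr_const.
by apply: ler_sum => i _; exact: zd.
Qed.

Let norm2_w e : square_summable (w e) /\ norm2 (w e) = D.
Proof.
have [|ws E] := @square_summable_finite _ M (w e).
  by move=> m Mm; rewrite /w big1// => i _; rewrite zM// mulr0.
split=> //; rewrite -[LHS]ger0_norm ?norm2_ge0// -sqrtr_sqr E /D /D2.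
congr Num.sqrt; rewrite exchange_big/=; apply: eq_bigr => m _.
rewrite /w expr2 mulr_suml; apply: eq_bigr => i _.
rewrite mulr_sumr (bigD1 i)//= [X in _ + X]big1 ?addr0.
  by rewrite mulrACA sgnM mul1r expr2.
by move=> j ji; rewrite mulrACA zz ?mulr0// eq_sym.
Qed.

(** At most one [z i] is nonzero at [m], and [kpf D] commutes with a sign. Since the normalization
    [D] is the same for all [e], the only dependence on [e] is linear, as the averaging requires. *)
Let KP_w e m : KP R (w e) m = \sum_i sgn e i * kpf D (z i m) :> R.
Proof.
rewrite KPE (norm2_w e).2 /w.
have [[i0 /eqP zi0]|/forallNP h] := pselect (exists i, z i m <> 0 :> R).
  have z0 i : i != i0 -> z i m = 0.
    move=> ii0; have /eqP := zz m ii0.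
    by rewrite mulf_eq0 (negbTE zi0) orbF => /eqP.
  rewrite (bigD1 i0)//= [in RHS](bigD1 i0)//= big1 => [|i /z0 ->]; last first.
    by rewrite mulr0.
  rewrite big1 => [|i /z0 ->]; last by rewrite kpf0 mulr0.
  rewrite !addr0 -(kpfM D _ (sgn_neq0 e i0)).
  by rewrite normr_sgn mul1r.
have z0 i : z i m = 0 :> R by have /contrapT -> := h i.
rewrite [in RHS]big1 => [|i _]; last by rewrite z0 kpf0 mulr0.
by rewrite big1 ?kpf0// => i _; rewrite z0 mulr0.
Qed.

Let zs i : square_summable (z i) /\
  norm2 (z i) ^+ 2 = \sum_(0 <= m < M) (z i m : R) ^+ 2.
Proof. by apply: square_summable_finite => m; exact: zM. Qed.

Let z_le i : norm2 (z i) <= K.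
Proof.
have [ps _] := cp i.
have h : norm2 (z i) <= norm2 (p i).2.
  apply: norm2_le => [|m]; first exact: norm2_ge0.
  apply: le_trans (sum_sqr_le_norm2 m ps); apply: ler_sum => k _.
  by have [->|->//] := zp i k; rewrite expr0n sqr_ge0.
apply: (le_trans h); apply: le_trans (pK i).
by rewrite lerDr norm2_ge0.
Qed.

Let z_gt0 i : 0 < norm2 (z i).
Proof.
rewrite lt0r norm2_ge0 andbT; apply/eqP => z0; have := zd i.
by rewrite -(zs i).2 z0 expr0n/= leNgt exprn_gt0.
Qed.

(* The average over signs of the pairings of [sum_i e_i p_i] with the lifts
   [(KP w, w)] of [w = sum_i e_i z_i]. *)
Let average_le : \sum_i \sum_(0 <= m < M)
   (((p i).1 m : R) * z i m - ((p i).2 m : R) * kpf D (z i m)) <=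
   (2 + 3 * c) * (K * Num.sqrt N%:R) * D.
Proof.
have [sX _ _] := @homogeneous_Z2 R.
(* The average is multiplied by the number [P] of sign patterns. Only diagonal terms survive the sum
   over [e], and each pairing is at most [2 + 3 c] times the quasi-norms [K sqrt N] and [D]. *)
pose P : R := #|{: {ffun 'I_N -> bool}}|%:R.
have P0 : 0 < P by rewrite ltr0n card_ffun card_bool expn_gt0.
rewrite -(ler_pM2l P0).
have cw e : car ((KP R (w e), w e) : amb (Z2 R)) by exact/car_KP/(norm2_w e).1.
have csum e : car (\sum_i sgn e i *: p i) by exact: (car_sum sX).
have E : P * (\sum_i \sum_(0 <= m < M)
    (((p i).1 m : R) * z i m - ((p i).2 m : R) * kpf D (z i m))) =
    \sum_e symp (\sum_i sgn e i *: p i) (KP R (w e), w e).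
  have symE e : symp (\sum_i sgn e i *: p i) (KP R (w e), w e) =
      \sum_(0 <= m < M)
      ((\sum_i sgn e i * ((p i).1 m : R)) * (\sum_i sgn e i * (z i m : R)) -
       (\sum_i sgn e i * ((p i).2 m : R)) *
         (\sum_i sgn e i * kpf D (z i m))).
    rewrite (@symp_finite _ _ M).
      by apply: eq_bigr => m _; rewrite /= KP_w sum_fst sum_snd.
    move=> m Mm; rewrite /= KP_w /w; split; rewrite big1// => i _; rewrite zM//.
      by rewrite kpf0 mulr0.
    by rewrite mulr0.
  under [RHS]eq_bigr do rewrite symE.
  rewrite [RHS]exchange_big/= [in LHS]exchange_big/= mulr_sumr.
  apply: eq_bigr => m _; rewrite !sumrB mulrBr.
  by rewrite -!sum_sgn_mul.
rewrite E.
apply: (@le_trans _ _ (\sum_(e : {ffun 'I_N -> bool})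
   (2 + 3 * c) * (K * Num.sqrt N%:R) * D)).
  apply: ler_sum => e _; apply: le_trans (ler_norm _) _.
  apply: (le_trans (symp_le (csum e) (cw e))).
  rewrite qn_KP (norm2_w e).2 ler_wpM2r ?sqrtr_ge0// ler_wpM2l//.
  exact: symp_const_ge0.
by rewrite sumr_const -[leLHS]mulr_natl.
Qed.

(** This is the pairing of [p i] with the lift of its own block, now normalized by [norm2 (z i)]
    instead of [D]; both quasi-norms are at most [K]. *)
Let single_ge i : - ((2 + 3 * c) * K * K) <=
  \sum_(0 <= m < M) (((p i).1 m : R) * z i m -
     ((p i).2 m : R) * kpf (norm2 (z i)) (z i m)).
Proof.
have cz := car_KP (zs i).1.
have -> : \sum_(0 <= m < M) (((p i).1 m : R) * z i m -
     ((p i).2 m : R) * kpf (norm2 (z i)) (z i m)) =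
     symp (p i) (KP R (z i), z i).
  rewrite (@symp_finite _ _ M); first by apply: eq_bigr => m _; rewrite /= KPE.
  by move=> m Mm; rewrite /= KPE zM// kpf0.
rewrite lerNl; apply: le_trans (ler_norm _) _; rewrite normrN.
apply: (le_trans (symp_le (cp i) cz)); rewrite qn_KP.
have c0 := @symp_const_ge0 R; have [_ _ q0] := @homogeneous_Z2 R.
apply: ler_pM => //; [|exact: norm2_ge0|exact: ler_wpM2l].
by apply: mulr_ge0 => //; exact: q0.
Qed.

(** Passing from the norms of the single blocks to [D] gains [c D2 (ln D - ln K - 1)], while all
    pairings are [O(D2)]. This bounds [ln D - ln K], hence [D2 >= N d^2], by a quantity free of
    [N]. *)
Lemma block_bound : N%:R * d ^+ 2 <=
  (K * expR (1 + (2 + 3 * c) * (K / d + (K / d) ^+ 2) / c)) ^+ 2.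
Proof.
have [N0|N0] := posnP N; first by rewrite N0 mul0r sqr_ge0.
have c0 : 0 < c := @kpc_gt0 R.
have NR : 0 < N%:R :> R by rewrite ltr0n.
have D20 : 0 < D2 by apply: lt_le_trans D2_ge; rewrite mulr_gt0 ?exprn_gt0.
have D0 : 0 < D by rewrite sqrtr_gt0.
have dN : d * Num.sqrt N%:R <= D.
  rewrite -ler_sqr ?nnegrE ?mulr_ge0 ?sqrtr_ge0 ?(ltW d0)//.
  by rewrite exprMn sqr_sqrtr ?ler0n// DD mulrC.
apply: le_trans D2_ge _; rewrite -DD ler_sqr ?nnegrE ?(ltW D0)//; last first.
  by rewrite mulr_ge0 ?expR_ge0 ?(ltW K0).
suff h : ln D - ln K <= 1 + (2 + 3 * c) * (K / d + (K / d) ^+ 2) / c.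
  have : ln D <= ln K + (1 + (2 + 3 * c) * (K / d + (K / d) ^+ 2) / c) by lra.
  by rewrite -ler_expR expRD !lnK ?posrE.
have lower : c * D2 * (ln D - ln K - 1) - N%:R * ((2 + 3 * c) * K * K) <=
   \sum_i \sum_(0 <= m < M)
   (((p i).1 m : R) * z i m - ((p i).2 m : R) * kpf D (z i m)).
  rewrite [N%:R * _]mulr_natl -[N in _ *+ N](card_ord N) -sumr_const.
  rewrite /D2 mulr_sumr mulr_suml -sumrB; apply: ler_sum => i _.
  apply: le_trans (lerD (lexx _) (single_ge i)) _.
  rewrite mulr_sumr mulr_suml -big_split/=; apply: ler_sum => m _.
  (* On the block the second coordinate of [p i] is [z i m], and elsewhere [kpf] vanishes, so the
     first-coordinate terms cancel and exactly this difference of normalizations remains. *)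
  have h : c * (z i m : R) ^+ 2 * (ln D - ln K - 1) <=
      (z i m : R) * (kpf (norm2 (z i)) (z i m) - kpf D (z i m)).
    apply: le_trans (kpf_sub_ge _ (z_gt0 i) D0).
    apply: ler_wpM2l; first by rewrite mulr_ge0 ?(ltW c0)// sqr_ge0.
    rewrite lerB// lerB//.
    by rewrite ler_ln ?posrE// z_le.
  rewrite -lerBrDr; apply: (le_trans h).
  by have [->|<-] := zp i m; [rewrite !kpf0; lra|lra].
have := le_trans lower average_le; rewrite lerBlDr => {}lower.
have c2 : 0 <= 2 + 3 * c := @symp_const_ge0 R.
(* The inequality [d sqrt N <= D] turns every occurrence of [N] into a multiple of [D2], which is
   then divided out. *)
have u1 : K * Num.sqrt N%:R * D <= K / d * D2.
  rewrite -DD expr2 mulrA ler_wpM2r ?(ltW D0)// -mulrA ler_wpM2l ?(ltW K0)//.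
  by rewrite mulrC ler_pdivlMr// mulrC.
have u2 : N%:R * (K * K) <= (K / d) ^+ 2 * D2.
  rewrite [leLHS]mulrC.
  have -> : (K / d) ^+ 2 * D2 = K * K * (D2 / d ^+ 2).
    by rewrite expr_div_n expr2 -!mulrA; congr (K * (K * _)); rewrite mulrC.
  by apply: ler_wpM2l; rewrite ?ler_pdivlMr ?exprn_gt0// mulr_ge0// ltW.
have u3 := ler_wpM2l c2 (lerD u1 u2).
have u : c * (ln D - ln K - 1) * D2 <=
    (2 + 3 * c) * (K / d + (K / d) ^+ 2) * D2.
  apply: le_trans (_ : (2 + 3 * c) * (K * Num.sqrt N%:R * D + N%:R * (K * K))
    <= _); last by apply: (le_trans u3); lra.
  by apply: le_trans (_ : c * D2 * (ln D - ln K - 1) <= _); lra.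
move: u; rewrite ler_pM2r// mulrC -ler_pdivlMr//; lra.
Qed.

End BlockBound.
End Blocks.

(** * Gliding hump *)

Section Selection.
Context {R : realType}.
Local Notation seqs := (@seq_space R).
Implicit Types (d e : R).

Lemma square_summable_eventually_le (a : seqs) e : square_summable a -> 0 < e ->
  exists n, forall k, (n <= k)%N -> `|a k : R| <= e.
Proof.
move=> as_ e0; have [n ne] := norm2_tail_small as_ e0.
exists n => k nk; have [ts _] := square_summable_trunc n a.
apply: le_trans ne; have := norm_le_norm2 k (square_summableB as_ ts).
rewrite -[(a - trunc n a) k]/((a k : R) - trunc n a k).
by rewrite /trunc ltnNge nk/= subr0.
Qed.

Lemma head_eventually_le (y : nat -> seqs) :
  (forall m e, 0 < e -> exists n, forall k, (n <= k)%N -> `|y k m : R| <= e) ->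
  forall M e, 0 < e -> exists n, forall k, (n <= k)%N ->
    \sum_(0 <= m < M) (y k m : R) ^+ 2 <= e ^+ 2.
Proof.
move=> y0; elim=> [|M IHM] e e0.
  by exists 0 => k _; rewrite big_geq ?sqr_ge0.
have e2 : 0 < e / 2 by rewrite divr_gt0.
have [n1 h1] := IHM _ e2; have [n2 h2] := y0 M _ e2.
exists (maxn n1 n2) => k; rewrite geq_max => /andP[k1 k2].
rewrite big_nat_recr//=; have := h1 k k1.
have : (y k M : R) ^+ 2 <= (e / 2) ^+ 2.
  by rewrite -real_normK ?num_real// lerXn2r ?nnegrE ?(ltW e2)// h2.
by have := sqr_ge0 e; rewrite expr_div_n; lra.
Qed.

(** Each new index is taken so late that the head before the current block start has norm at most
    [d / 2]. The norm exceeds [d], so a far enough end leaves a square mass above [3/4 d^2] in the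
    block. *)
Lemma exists_blocks (y : nat -> seqs) d :
  (forall k, square_summable (y k)) ->
  (forall m e, 0 < e -> exists n, forall k, (n <= k)%N -> `|y k m : R| <= e) ->
  0 < d -> (forall n, exists2 k, (n <= k)%N & d < norm2 (y k)) ->
  exists (kappa b : nat -> nat), [/\ injective kappa,
    {homo b : i j / (i <= j)%N} &
    forall i, (d / 2) ^+ 2 <=
      \sum_(b i <= m < b i.+1) (y (kappa i) m : R) ^+ 2].
Proof.
move=> ys y0 d0 yd.
(* [s] holds the least admissible index and the block start, [t] the chosen index and the block
   end. *)
have step (s : nat * nat) : exists t : nat * nat, [/\ (s.1 <= t.1)%N,
    (s.2 <= t.2)%N & (d / 2) ^+ 2 <= \sum_(s.2 <= m < t.2) (y t.1 m : R) ^+ 2].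
  have d2 : 0 < d / 2 by rewrite divr_gt0.
  have [n hn] := head_eventually_le y0 s.2 d2.
  have [k kn kd] := yd (maxn s.1 n).
  move: kn; rewrite geq_max => /andP[k1 /hn kh].
  have [M hM] : exists M, d ^+ 2 < \sum_(0 <= m < M) (y k m : R) ^+ 2.
    apply/not_existsP => h; suff : norm2 (y k) <= d by rewrite leNgt kd.
    apply: norm2_le => [|M]; first exact: ltW.
    by rewrite leNgt; apply/negP; exact: h.
  exists (k, maxn s.2 M); split=> //=; first exact: leq_maxl.
  have : d ^+ 2 < \sum_(0 <= m < maxn s.2 M) (y k m : R) ^+ 2.
    apply: (lt_le_trans hM).
    rewrite [leRHS](big_cat_nat (leq0n _) (leq_maxr s.2 M))//= lerDl.
    by apply: sumr_ge0 => i _; exact: sqr_ge0.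
  rewrite (big_cat_nat (leq0n _) (leq_maxl s.2 M))//=.
  by have := sqr_ge0 d; move: kh; rewrite expr_div_n; lra.
have [F hF] := choice step.
(* The successor on the index makes the chosen indices strictly increasing; the end of a block is
   the start of the next. *)
pose st := fix st n := if n is n'.+1 then
  ((F (st n')).1.+1, (F (st n')).2) else (0, 0).
exists (fun i => (F (st i)).1), (fun i => (st i).2); split.
- have kS i : ((F (st i)).1 < (F (st i.+1)).1)%N.
    by have [] := hF (st i.+1).
  have kmono := homo_ltn ltn_trans kS.
  by move=> i j /eqP; case: (ltngtP i j) => // /kmono; case: ltngtP.
- apply: homo_leq => [//|? ? ?|i]; first exact: leq_trans.
  by have [] := hF (st i).
- by move=> i; have [] := hF (st i).
Qed.

End Selection.

(** * Sequences with an upper square-function estimate *)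

Section StrictSingularity.
Context {R : realType}.
Local Notation seqs := (@seq_space R).
Implicit Types (p : nat -> amb (Z2 R)) (K d : R).

Lemma norm2_snd_eventually_le p K d : 0 < K -> (forall k, car (p k)) ->
  (forall n (kappa : 'I_n -> nat) (a : 'I_n -> R), injective kappa ->
    qn (\sum_i a i *: p (kappa i)) <= K * Num.sqrt (\sum_i a i ^+ 2)) ->
  0 < d -> exists n, forall k, (n <= k)%N -> norm2 (p k).2 <= d.
Proof.
move=> K0 cp pK d0; have [sX _ _] := @homogeneous_Z2 R.
have ps k : square_summable (p k).2 by have [] := cp k.
have snd_le w : car w -> norm2 (w : amb (Z2 R)).2 <= qn w.
  by move=> _; rewrite /= lerDr norm2_ge0.
(* The coefficients [a_i = (p i).2 m] are tested against themselves: the sum of the [a_i^2] is the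
   [m]-th second coordinate of the combination, hence at most [K] times its own square root. *)
have coord m e : 0 < e ->
    exists n, forall k, (n <= k)%N -> `|(p k).2 m : R| <= e.
  apply: (@square_summable_eventually_le _ (fun k => (p k).2 m)).
  apply: (@square_summable_self_bound _ _ K _ _).1; first exact: ltW.
  move=> n; pose a (i : 'I_n) : R := (p i).2 m.
  have [_ E] := square_summable_trunc n (fun k => (p k).2 m).
  have -> : norm2 (trunc n (fun k => (p k).2 m)) = Num.sqrt (\sum_i a i ^+ 2).
    by rewrite -[LHS]ger0_norm ?norm2_ge0// -sqrtr_sqr E big_mkord.
  apply: le_trans (pK _ _ a (@ord_inj n)).
  have cs : car (\sum_i a i *: p i) by exact: (car_sum sX).
  apply: le_trans (snd_le _ cs); have [ss _] := cs.
  apply: le_trans (norm_le_norm2 m ss); apply: le_trans (ler_norm _).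
  by rewrite sum_snd big_mkord; apply: ler_sum => i _; rewrite expr2.
apply: contrapT => h.
have often n : exists2 k, (n <= k)%N & d < norm2 (p k).2.
  apply: contrapT => hn; apply: h; exists n => k nk; rewrite leNgt.
  by apply/negP => kd; apply: hn; exists k.
have [kappa [b [kinj bmono mass]]] :=
  exists_blocks (fun k => ps k) coord d0 often.
have d2 : 0 < d / 2 by rewrite divr_gt0.
pose C : R := (K *
  expR (1 + (2 + 3 * kpc) * (K / (d / 2) + (K / (d / 2)) ^+ 2) / kpc)) ^+ 2.
(* [C] is the constant of [block_bound] for blocks of norm at least [d / 2]. It is the same for all
   [N], which contradicts the Archimedean property. *)
suff bound N : N%:R * (d / 2) ^+ 2 <= C.
  pose N := (Num.bound (C / (d / 2) ^+ 2)).
  have /ltW C0 : 0 < C.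
    by rewrite exprn_gt0// mulr_gt0// expR_gt0.
  have : C / (d / 2) ^+ 2 < N%:R.
    by apply: archi_boundP; rewrite divr_ge0// sqr_ge0.
  by rewrite ltr_pdivrMr ?exprn_gt0// ltNge bound.
pose z (i : 'I_N) : seqs :=
  fun m => if (b i <= m < b i.+1)%N then (p (kappa i)).2 m else 0.
have zz0 (i j : 'I_N) m : (i < j)%N -> (z i m : R) * z j m = 0.
  move=> ij; rewrite /z; case: ifP => [/andP[_ mi]|_]; last by rewrite mul0r.
  rewrite [(b j <= m)%N]leqNgt (leq_trans mi) ?mulr0//=.
  exact: (bmono i.+1 j ij).
apply: (@block_bound R N (b N) (fun i : 'I_N => p (kappa i)) z K (d / 2)) => //.
- move=> i; have inj1 : injective (fun _ : 'I_1 => kappa i).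
    by move=> x y _; rewrite (ord1 x) (ord1 y).
  have := pK 1 _ (fun=> 1) inj1.
  by rewrite !big_ord1 scale1r expr1n sqrtr1 mulr1.
- move=> e; apply: le_trans (pK _ (fun i : 'I_N => kappa i) (sgn e) _) _.
    by move=> i j /kinj/ord_inj.
  under eq_bigr do rewrite expr2 sgnM.
  by rewrite sumr_const card_ord.
- by move=> i m; rewrite /z; case: ifP; [right|left].
- move=> i m Nm; have Sm := leq_trans (bmono i.+1 N (ltn_ord i)) Nm.
  by rewrite /z [(m < _)%N]ltnNge Sm andbF.
- move=> i j m; rewrite neq_ltn => /orP[ij|ji]; first exact: zz0.
  by rewrite mulrC zz0.
- move=> i; apply: (le_trans (mass i)).
  rewrite [leRHS](big_cat_nat (leq0n _) (bmono _ _ (ltn_ord i)))//=.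
  rewrite (big_cat_nat (leq0n _) (bmono _ _ (leqnSn i)))//=.
  rewrite -[leLHS]add0r -[leLHS]addr0 !lerD//; last first.
  - by apply: sumr_ge0 => k _; exact: sqr_ge0.
  - by apply: ler_sum_nat => m bm; rewrite /z bm.
  - by apply: sumr_ge0 => k _; exact: sqr_ge0.
Qed.

Lemma dot_unit_seq i j : dot (@unit_seq R i) (unit_seq j) = (i == j)%:R.
Proof. by rewrite dot_unit_seqr /unit_seq eq_sym. Qed.

Lemma ell2_operator_snd (A : seqs -> amb (Z2 R)) K d :
  @linear_map R (ell2 R) (Z2 R) A -> 0 < K ->
  (forall x, square_summable x -> qn (A x) <= K * norm2 x) -> 0 < d ->
  exists n, forall k, (n <= k)%N -> norm2 (A (unit_seq k)).2 <= d.
Proof.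
move=> lA K0 AK d0; have [sX _ _] := @homogeneous_ell2 R.
have es k := @square_summable_unit_seq R k.
apply: (@norm2_snd_eventually_le (fun k => A (unit_seq k)) K) => // [k|].
  exact: (lA.1 _ (es k)).
move=> n kappa a kinj.
rewrite -(linear_map_sum sX lA _ a (fun i => es (kappa i))).
apply: (le_trans (AK _ _)); first exact: square_summable_sum.
by rewrite norm2_orthonormal// => i j; rewrite dot_unit_seq (inj_eq kinj).
Qed.

End StrictSingularity.

(** * Singularity of the differential and absence of complemented Hilbert copies *)

Section Singular.
Context {R : realType}.
Local Notation seqs := (@seq_space R).
Implicit Types (u : nat -> amb (Z2 R)) (W : set (amb (Z2 R))).

Lemma snd_sum (I : Type) (r : seq I) (F : I -> amb (Z2 R)) :
  (\sum_(i <- r) F i).2 = \sum_(i <- r) (F i).2.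
Proof. by elim/big_rec2: _ => // i u v _ <-. Qed.

Let orthonormal n u := forall i j, (i < n)%N -> (j < n)%N ->
  dot (u i).2 (u j).2 = (i == j)%:R.

(** A Gram-Schmidt step performed on second coordinates but inside [W]: the projection is a
    combination of the [u i] themselves. *)
Lemma exists_next_orthonormal n u W :
  Defs.subspace (W : set (amb (Z2 R))) -> ~ @finite_dimensional R (Z2 R) W ->
  (forall w, W w -> w.2 = 0 -> w = 0) ->
  (forall i, (i < n)%N -> W (u i)) -> orthonormal n u ->
  exists v, [/\ W v, dot v.2 v.2 = 1 &
                forall i, (i < n)%N -> dot v.2 (u i).2 = 0].
Proof.
move=> sW infW injW Wu uu; have [WX W0 WD] := sW.
have hsW : homogeneous (@induced R (Z2 R) W).
  exact: homogeneous_induced homogeneous_Z2 sW.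
have sW' : Defs.subspace (@car R (@induced R (Z2 R) W)) by have [] := hsW.
have W2 w : W w -> square_summable w.2 by move=> /WX[].
pose proj (w : amb (Z2 R)) : amb (Z2 R) := \sum_(i < n) dot w.2 (u i).2 *: u i.
(* If [proj] fixed all of [W], the finitely many [u i] would span it. Injectivity then makes the
   second coordinate of [w - proj w] nonzero. *)
have [w Ww wp] : exists2 w, W w & w <> proj w.
  apply: contrapT => h; apply: infW; exists n, (fun i : 'I_n => u i) => w Ww.
  exists (fun i : 'I_n => dot w.2 (u i).2); apply: contrapT => wp.
  by apply: h; exists w.
have Wp : W (proj w).
  by apply: (car_sum sW') => i; exact: Wu.
have Wv : W (w - proj w) by exact: (car_sub sW').
have v0 : (w - proj w).2 <> 0.
  by move=> /(injW _ Wv)/eqP; rewrite subr_eq0 => /eqP.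
have N0 := norm2_gt0 (W2 _ Wv) v0.
have WZ a x : W x -> W (a *: x) by move=> Wx; rewrite -[a *: x]addr0; exact: WD.
exists ((norm2 (w - proj w).2)^-1 *: (w - proj w)); split; first exact: WZ.
  rewrite dotxx; last exact: (W2 _ (WZ _ _ Wv)).
  rewrite -[(_ *: _).2]/(_ *: (w - proj w).2) norm2Z; last exact: W2.
  by rewrite gtr0_norm ?invr_gt0// mulVf ?expr1n// gt_eqF.
move=> i ni; have ui := W2 _ (Wu i ni).
rewrite -[(_ *: _).2]/(_ *: (w - proj w).2) -[X in dot X _]addr0.
rewrite dot_linearl//; [|exact: W2|exact: square_summable0].
rewrite {2}/dot (@lim_series_finite _ _ 0) ?big_geq ?addr0//; last first.
  by move=> m _; rewrite mul0r.
suff -> : dot (w - proj w).2 (u i).2 = 0 by rewrite mulr0.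
rewrite -[(w - proj w).2]/(w.2 - (proj w).2) addrC -scaleN1r.
rewrite dot_linearl//; [|exact: W2..].
rewrite /proj snd_sum.
rewrite (@dot_suml R 'I_n _ (fun k => dot w.2 (u k).2) (fun k => (u k).2))//.
  rewrite (bigD1 (Ordinal ni))//= uu// eqxx mulr1 big1 ?addr0 ?mulN1r ?addNr//.
  by move=> k; rewrite -val_eqE/= => ki; rewrite uu// (negbTE ki) mulr0.
by move=> k; exact/W2/Wu.
Qed.

Lemma exists_orthonormal W :
  Defs.subspace (W : set (amb (Z2 R))) -> ~ @finite_dimensional R (Z2 R) W ->
  (forall w, W w -> w.2 = 0 -> w = 0) ->
  exists u, (forall i, W (u i)) /\
    forall i j, dot (u i).2 (u j).2 = (i == j)%:R.
Proof.
move=> sW infW injW.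
pose good n u := (forall i, (i < n)%N -> W (u i)) /\ orthonormal n u.
(* The choice function is defined on all lists, with default 0 on those that are not orthonormal in
   [W]. Lists are used because each vector depends on all its predecessors. *)
have step (l : seq (amb (Z2 R))) : exists v, good (size l) (nth 0 l) ->
    [/\ W v, dot v.2 v.2 = 1 &
        forall i, (i < size l)%N -> dot v.2 (nth 0 l i).2 = 0].
  have [[gW go]|ng] := pselect (good (size l) (nth 0 l)); last by exists 0.
  by have [v hv] := exists_next_orthonormal sW infW injW gW go; exists v.
have [F hF] := choice step.
pose l := fix l n := if n is n'.+1 then rcons (l n') (F (l n')) else [::].
pose u n := F (l n).
have lE n : l n = mkseq u n by elim: n => //= n {1}->; rewrite mkseqS.
have nthE n i : (i < n)%N -> nth 0 (l n) i = u i.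
  by move=> ni; rewrite lE nth_mkseq.
have sz n : size (l n) = n by rewrite lE size_mkseq.
have gS n : good n u -> [/\ W (u n), dot (u n).2 (u n).2 = 1 &
    forall i, (i < n)%N -> dot (u n).2 (u i).2 = 0].
  move=> [gW go]; have [|Wn nn ni] := hF (l n).
    split=> [i|i j]; rewrite sz => ?; first by rewrite nthE//; exact: gW.
    by move=> ?; rewrite !nthE//; exact: go.
  by split=> // i i_n; rewrite -(nthE n i i_n); apply: ni; rewrite sz.
have g n : good n u.
  elim: n => [|n gn]; first by split.
  have [Wn nn ni] := gS n gn; have [gW go] := gn.
  split=> [i|i j]; rewrite ltnS leq_eqVlt => /predU1P[->//|i_n].
  - exact: gW.
  - rewrite ltnS leq_eqVlt => /predU1P[->//|jn]; first by rewrite eqxx.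
    by rewrite ni// gtn_eqF.
  - rewrite ltnS leq_eqVlt => /predU1P[->//|jn]; last exact: go.
    by rewrite dotC ni// ltn_eqF.
exists u; split=> [i|i j]; first by have [h _] := g i.+1; exact: h.
have [_ h] := g (maxn i j).+1.
by apply: h; rewrite ltnS ?leq_maxl ?leq_maxr.
Qed.

(** A bounded inverse of the quotient map on [W] gives [qn w <= K * norm2 w.2], so vectors of [W]
    with orthonormal second coordinates satisfy the upper estimate. Their second coordinates would
    then have norm at most 1/2 eventually, yet it is 1. *)
Lemma singular_KP : singular (KP R).
Proof.
move=> W [sW _] infW [lT kT [S [lS kS ST TS]]].
have [WX W0 WD] := sW.
pose V : set (amb (ell2 R)) := @quotient_map R (KP R) @` W.
have sV : Defs.subspace (V : set (amb (ell2 R))).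
  split=> [_ [w /WX[w2 _] <-]//||a _ _ [x Wx <-] [y Wy <-]]; first by exists 0.
  by exists (a *: x + y); first exact: WD.
have hV := homogeneous_induced (@homogeneous_ell2 R) sV.
have sV' : Defs.subspace (@car R (@induced R (ell2 R) V)) by have [] := hV.
have hW := homogeneous_induced (@homogeneous_Z2 R) sW.
have [K K0 SK] := continuous_bounded sV' lS hV hW kS.
have WK w : W w -> qn w <= K * norm2 w.2.
  move=> Ww; rewrite -{1}(ST w Ww); apply: SK; by exists w.
have injW w : W w -> w.2 = 0 -> w = 0.
  move=> Ww w20; rewrite -(ST w Ww) /quotient_map w20.
  exact: (linear_map0 sV' lS).
have [u [Wu uu]] := exists_orthonormal sW infW injW.
have us i : square_summable (u i).2 by have [] := WX _ (Wu i).
have h2 : 0 < 2^-1 :> R by rewrite invr_gt0.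
have [|n h] := norm2_snd_eventually_le K0 (fun k => WX _ (Wu k)) _ h2.
  move=> n kappa a kinj.
  have Ws : W (\sum_i a i *: u (kappa i)).
    have sW' : Defs.subspace (@car R (@induced R (Z2 R) W)) by have [] := hW.
    by apply: (car_sum sW') => i; exact: Wu.
  apply: (le_trans (WK _ Ws)); rewrite snd_sum.
  rewrite -[X in norm2 X]/(\sum_i a i *: (u (kappa i)).2).
  by rewrite norm2_orthonormal// => i j; rewrite uu (inj_eq kinj).
have := h n (leqnn n); have : norm2 (u n).2 ^+ 2 = 1.
  by rewrite -dotxx// uu eqxx.
by have := norm2_ge0 (u n).2; nra.
Qed.

(** The functional [z |-> dot (B z) t] on [Z2] is represented by a vector [A t] through
    self-duality; [of_dual] contributes the factor [2 + 3 kpc]. *)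
Lemma exists_adjoint (B : amb (Z2 R) -> seqs) (K : R) :
  @linear_map R (Z2 R) (ell2 R) B -> 0 < K ->
  (forall z, @car R (Z2 R) z -> norm2 (B z) <= K * qn z) ->
  exists A : seqs -> amb (Z2 R), [/\ @linear_map R (ell2 R) (Z2 R) A,
    forall t, square_summable t -> qn (A t) <= (2 + 3 * kpc) * K * norm2 t &
    forall t z, square_summable t -> car z -> symp (A t) z = dot (B z) t].
Proof.
move=> lB K0 BK; have [[_ _ cD] _ _] := @homogeneous_Z2 R.
pose f (t : seqs) : amb (dual (Z2 R)) :=
  fun z => if pselect (car z) then dot (B z) t else 0.
have fE t z : car z -> f t z = dot (B z) t by rewrite /f; case: pselect.
have f0 t z : ~ car z -> f t z = 0 by rewrite /f; case: pselect.
have fK t z : square_summable t -> car z ->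
    `|f t z : R| <= K * norm2 t * qn z.
  move=> ts cz; rewrite fE//.
  apply: (le_trans (cvg_dot (lB.1 _ cz) ts).2).
  by rewrite mulrAC ler_wpM2r ?norm2_ge0// BK.
have K1 t : 0 <= K * norm2 t by rewrite mulr_ge0 ?norm2_ge0 ?(ltW K0).
have cf t : square_summable t -> car (f t).
  move=> ts; apply: (car_dual homogeneous_Z2 _ (K1 t)).
  - split=> // a x y cx cy; rewrite !fE//; last exact: cD.
    by rewrite lB.2// dot_linearl//; exact: lB.1.
  - by move=> z; exact: fK.
  - exact: f0.
exists (fun t => of_dual (f t)); split.
- split=> [t ts|a t t' ts ts']; first exact/car_of_dual/cf.
  rewrite -linear_of_dual.2; [|exact: cf..].
  congr (of_dual _); apply/funext => z.
  rewrite -[RHS]/(a * (f t z : R) + f t' z).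
  have [cz|cz] := pselect (car z); last by rewrite !f0// mulr0 addr0.
  by rewrite !fE// dot_linearr//; exact: lB.1.
- move=> t ts; apply: (le_trans (of_dual_bound (cf _ ts))).
  rewrite -mulrA ler_wpM2l ?symp_const_ge0//.
  by apply: (dual_norm_le homogeneous_Z2 (cf _ ts) (K1 t)) => z; exact: fK.
- move=> t z ts cz; rewrite -fE// -{2}(of_dualK (cf _ ts)).
  by rewrite to_dualE.
Qed.

(** Here [V] embeds [ell2] onto [W], [U \o P] is its left inverse on [Z2], and [A] is the adjoint of
    [U \o P] for the form. *)
Lemma no_complemented_ell2 :
  ~ exists W : set (amb (Z2 R)), complemented_copy (Z2 R) (ell2 R) W.
Proof.
move=> [W [[sW _] [U [lU kU [V [lV kV VU UV]]]] [P [lP kP PP PW]]]].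
have [WX _ _] := sW; have hZ := @homogeneous_Z2 R; have [sZ _ Z0] := hZ.
have hE := @homogeneous_ell2 R; have [sE _ _] := hE.
have hW := homogeneous_induced hZ sW; have [sW' _ _] := hW.
have [KU KU0 hU] := continuous_bounded sW' lU hW hE kU.
have [KV KV0 hV] := continuous_bounded sE lV hE hW kV.
have [Kp KP0 hP] := continuous_bounded sZ lP hZ hZ kP.
have WP z : car z -> W (P z) by move=> cz; rewrite -PW; exists z.
have lV' : @linear_map R (ell2 R) (Z2 R) V.
  by split; [move=> x /lV.1/WX|exact: lV.2].
have lB : @linear_map R (Z2 R) (ell2 R) (U \o P).
  split=> [z /WP/lU.1//|a x y cx cy /=].
  by rewrite lP.2// lU.2//; exact: WP.
have BK z : @car R (Z2 R) z -> norm2 ((U \o P) z) <= KU * Kp * qn z.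
  move=> cz; apply: (le_trans (hU _ (WP _ cz))); rewrite -mulrA.
  by apply: ler_wpM2l; [exact: ltW|exact: hP].
have K0 : 0 < KU * Kp by exact: mulr_gt0.
have [A [lA AK AE]] := exists_adjoint lB K0 BK.
have c0 := @kpc_gt0 R.
pose KA : R := (2 + 3 * kpc) * (KU * Kp); rewrite -/KA in AK.
have KA0 : 0 < KA by rewrite mulr_gt0//; lra.
(* With both second coordinates at most [d <= 1], the three terms of [cvg_symp] sum to at most
   [d (KA + KV + 3 kpc)], which is below 1/2. *)
pose d : R := (2 * (1 + KA + KV + 3 * kpc))^-1.
have d0 : 0 < d by rewrite invr_gt0; lra.
have [n1 h1] := ell2_operator_snd lA KA0 AK d0.
have [n2 h2] := ell2_operator_snd lV' KV0 hV d0.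
pose n := maxn n1 n2; pose e : seqs := unit_seq n.
have es : square_summable e by exact: square_summable_unit_seq.
have e1 : norm2 e = 1.
  by rewrite -[LHS]ger0_norm ?norm2_ge0// -sqrtr_sqr -dotxx// dot_unit_seq
    eqxx sqrtr1.
have cA : car (A e) by exact: lA.1.
have cV : @car R (Z2 R) (V e) by exact: (lV'.1 e es).
have PV : P (V e) = V e.
  have : W (V e) := lV.1 e es.
  by rewrite -PW => -[z cz <-]; exact: PP.
(* The adjoint relation moves the pairing to [dot (U (P (V e))) e], and [P] fixes the range of
   [V]. *)
have one : symp (A e) (V e) = 1.
  rewrite AE//= PV UV// dot_unit_seq eqxx//.
have [_] := cvg_symp cA cV; rewrite one normr1.
have := h1 n (leq_maxl _ _); have := h2 n (leq_maxr _ _).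
have := AK e es; have := hV e es; rewrite /= e1 !mulr1.
set v1 := norm2 ((V e).1 - _); set v2 := norm2 (V e).2.
set a1 := norm2 ((A e).1 - _); set a2 := norm2 (A e).2.
have [v10 v20 a10 a20] : [/\ 0 <= v1, 0 <= v2, 0 <= a1 & 0 <= a2].
  by split; exact: norm2_ge0.
move=> vK aK v2d a2d; apply/negP; rewrite -ltNge.
have c3 : 0 <= 3 * @kpc R by lra.
have dD : d * (1 + KA + KV + 3 * kpc) = 2^-1.
  by rewrite /d invfM -mulrA mulVf ?mulr1// gt_eqF//; lra.
have t1 : a1 * v2 <= KA * d by apply: ler_pM => //; lra.
have t2 : a2 * v1 <= d * KV by apply: ler_pM => //; lra.
have d1 : d <= 1.
  have := mulr_gt0 d0 KA0; have := mulr_gt0 d0 KV0.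
  by have := mulr_ge0 (ltW d0) c3; lra.
have t3 : 3 * kpc * a2 * v2 <= 3 * kpc * d.
  apply: ler_pM => //; first exact: mulr_ge0.
  by rewrite -[leRHS]mulr1 ler_wpM2l// (le_trans a2d).
lra.
Qed.

End Singular.

Theorem proposition2 (R : realType) :
  [/\ isomorphic (Z2 R) (dual (Z2 R)),
      singular (KP R) &
      ~ exists W : set (amb (Z2 R)), complemented_copy (Z2 R) (ell2 R) W].
Proof.
split; [exact: isomorphic_dual|exact: singular_KP|exact: no_complemented_ell2].
Qed.
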